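(* In the streaming PCA setting, consider the Krasulina–Oja iterates and $L_t:=\sin^2(\hat{\bm v}_t,\bm v_1)$. Let $\delta\in(0,1)$ and suppose $\mathbb P(L_0\le1/4)\ge1-\delta^3$. Define $L:=\max\{\lceil128B^4\log(\delta^{-1})^2/\rho^2\rceil;32\}$ and choose the step sizes $\eta_t=\frac{2}{\rho(t+L)}$. Then with probability at least $1-2(e+1)\delta$, uniformly over all $t\ge0$, $$L_t\le\max\Big\{\frac{252L}{\log(\delta^{-1})};\frac{1008B^4}{\rho^2}\Big\}\cdot\frac{\log(\delta^{-1})+2\log\log(t+9)}{t+L}.$$
   Context: Streaming PCA setting: $\bm X_1,\bm X_2,\dots\in\mathbb R^p$ are i.i.d. centered random vectors with covariance matrix $\bm\Sigma$, and $\|\bm X_i\|\le B$ almost surely. The eigenvalues of $\bm\Sigma$ in decreasing order are $\lambda_1>\lambda_2\ge\dots\ge\lambda_p$, $\bm v_1$ is a unit eigenvector for $\lambda_1$, and $\rho:=\lambda_1-\lambda_2$ is the eigengap. $\hat{\bm v}_0$ is a random unit vector independent of $(\bm X_t)$. $\{\eta_t\}_{t\ge1}$ are deterministic positive step sizes. Krasulina–Oja update: with $y_t:=\bm X_t^\top\hat{\bm v}_{t-1}$, $\hat{\bm v}_t=\hat{\bm v}_{t-1}+\eta_t\,y_t\big[\bm X_t-\frac{y_t}{\|\hat{\bm v}_{t-1}\|^2}\hat{\bm v}_{t-1}\big]$. For non-zero $\bm x,\bm y$, $\sin^2(\bm x,\bm y):=1-\frac{\langle\bm x,\bm y\rangle^2}{\|\bm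 x\|^2\|\bm y\|^2}$. $\mathcal F_t:=\sigma(\hat{\bm v}_0,\bm X_1,\dots,\bm X_t)$. *)

(* Defs.v *)
From HB Require Import structures.
From mathcomp Require Import all_boot all_order all_algebra.
From mathcomp Require Import all_classical all_reals all_analysis.
Set Implicit Arguments. Unset Strict Implicit. Unset Printing Implicit Defensive.
Import Order.TTheory GRing.Theory Num.Theory.
Local Open Scope classical_set_scope.
Local Open Scope ring_scope.

Definition dotv (R : realType) (p : nat) (u v : 'cV[R]_p) : R :=
  \sum_(i < p) u i 0 * v i 0.

Definition normv (R : realType) (p : nat) (u : 'cV[R]_p) : R :=
  Num.sqrt (dotv u u).

Definition sin2 (R : realType) (p : nat) (x y : 'cV[R]_p) : R :=
  1 - (dotv x y) ^+ 2 / (dotv x x * dotv y y).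

(* Krasulina--Oja iterates:
   vhat 0 = v0,
   vhat t = vhat (t-1) + eta t * y_t * (X t - y_t / ||vhat (t-1)||^2 * vhat (t-1)),
   with y_t = X_t^T vhat (t-1).  X 0 and eta 0 are not used. *)
Fixpoint KOiter (R : realType) (p : nat) (T : Type)
  (v0 : T -> 'cV[R]_p) (X : nat -> T -> 'cV[R]_p) (eta : nat -> R) (t : nat)
  (w : T) : 'cV[R]_p :=
  match t with
  | 0 => v0 w
  | t'.+1 =>
      let v := KOiter v0 X eta t' w in
      let y := dotv (X t'.+1 w) v in
      v + (eta t'.+1 * y) *: (X t'.+1 w - (y / dotv v v) *: v)
  end.

(* sigma-algebra on R^p generated by the coordinate cylinders (= product Borel). *)
Definition cyl_sets (R : realType) (p : nat) : set (set 'cV[R]_p) :=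
  [set A | exists i : 'I_p, exists B : set R,
       measurable B /\ A = [set v : 'cV[R]_p | B (v i 0)]].

Definition borel_vec (R : realType) (p : nat) : set (set 'cV[R]_p) :=
  <<s @cyl_sets R p >>.

Definition sigma_of (T : Type) (R : realType) (p : nat) (Y : T -> 'cV[R]_p)
  : set (set T) :=
  [set A | exists C, @borel_vec R p C /\ A = Y @^-1` C].

Definition mutually_independent (d : measure_display) (T : measurableType d)
  (R : realType) (P : probability T R) (p : nat) (Y : nat -> T -> 'cV[R]_p) :=
  forall (s : seq nat) (A : nat -> set T), uniq s ->
    (forall k, k \in s -> sigma_of (Y k) (A k)) ->
    P (\bigcap_(k in [set k | k \in s]) A k) = (\prod_(k <- s) P (A k))%E.

Definition same_law (d : measure_display) (T : measurableType d)
  (R : realType) (P : probability T R) (p : nat) (Y1 Y2 : T -> 'cV[R]_p) :=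
  forall C, @borel_vec R p C -> P (Y1 @^-1` C) = P (Y2 @^-1` C).

Definition random_vec (d : measure_display) (T : measurableType d)
  (R : realType) (p : nat) (Y : T -> 'cV[R]_p) :=
  forall i : 'I_p, measurable_fun setT (fun w => Y w i 0).

(* Main.v *)
Require Import Defs.
From HB Require Import structures.
From mathcomp Require Import all_boot all_order all_algebra.
From mathcomp Require Import all_classical all_reals all_analysis.
From mathcomp Require Import measurable_realfun.
From mathcomp Require Import ring lra.
Import Order.TTheory GRing.Theory Num.Theory.
Local Open Scope classical_set_scope.
Local Open Scope ring_scope.
Set Implicit Arguments. Unset Strict Implicit. Unset Printing Implicit Defensive.

(* Write S_t for [sin2] of the iterate, n = t + L, b = B^2 / rho >= 1 and
   theta = 1 / (8 b^2).  One update gives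
     S_{t+1} <= S_t - 2 eta D + eta^2 B^4 / 4,   D^2 <= B^4 S_t / 4,
   where D is quadratic in X_{t+1}, with conditional mean >= rho S_t (1 - S_t).
   Since theta n eta D is bounded, e^z <= 1 + z + z^2 applies, and only E[D | past]
   is needed: while S_t <= 1/2, the process W_t = exp (theta n S_t) satisfies
     E[W_{t+1} | past] <= W_t + 1 / (n + 1).
   With a_t = 1 + ln (n / L), the process G_t = W_t / a_t^2 + 1 / a_t is then a
   supermartingale, because 1 / a_t - 1 / a_{t+1} >= 1 / ((n + 1) a_{t+1}^2).
   Ville's inequality keeps G_t below K = 2 exp (theta L / 4) / delta for all t with
   probability 1 - delta, starting from S_0 <= 1/4.  As theta L >= 16 ln(1/delta)^2,
   this threshold itself forces S_t <= 1/2, so the argument closes; taking logarithms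
   gives theta n S_t <= ln K + 2 ln a_t, hence the iterated logarithm. *)

(** * Euclidean inner product on column vectors *)

Section DotProduct.
Context {R : realType} {p : nat}.
Implicit Types u v w : 'cV[R]_p.

Lemma dotvC u v : dotv u v = dotv v u.
Proof. by apply: eq_bigr => i _; rewrite mulrC. Qed.

Lemma dotvDl u v w : dotv (u + v) w = dotv u w + dotv v w.
Proof. by rewrite -big_split; apply: eq_bigr => i _; rewrite mxE mulrDl. Qed.

Lemma dotvZl a u w : dotv (a *: u) w = a * dotv u w.
Proof. by rewrite /dotv mulr_sumr; apply: eq_bigr => i _; rewrite mxE mulrA. Qed.

Lemma dotvDr u v w : dotv w (u + v) = dotv w u + dotv w v.
Proof. by rewrite dotvC dotvDl !(dotvC w). Qed.

Lemma dotvZr a u w : dotv w (a *: u) = a * dotv w u.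
Proof. by rewrite dotvC dotvZl (dotvC w). Qed.

Lemma dotvNl u w : dotv (- u) w = - dotv u w.
Proof. by rewrite -scaleN1r dotvZl mulN1r. Qed.

Lemma dotvNr u w : dotv w (- u) = - dotv w u.
Proof. by rewrite dotvC dotvNl dotvC. Qed.

Definition dotvE := (dotvDl, dotvDr, dotvZl, dotvZr, dotvNl, dotvNr).

Lemma dotv_ge0 u : 0 <= dotv u u.
Proof. by apply: sumr_ge0 => i _; rewrite -expr2 sqr_ge0. Qed.

Lemma sqr_coord_le_dotv u i : u i 0 ^+ 2 <= dotv u u.
Proof.
rewrite /dotv (bigD1 i)//= -expr2 lerDl.
by apply: sumr_ge0 => j _; rewrite -expr2 sqr_ge0.
Qed.

Lemma dotv_eq0 u v : dotv v v = 0 -> dotv u v = 0.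
Proof.
move=> v0; rewrite /dotv big1 // => i _.
have := sqr_coord_le_dotv v i; rewrite v0 => h.
have : v i 0 ^+ 2 == 0 by rewrite eq_le h sqr_ge0.
by rewrite sqrf_eq0 => /eqP ->; rewrite mulr0.
Qed.

Lemma dotv_CauchySchwarz u v : dotv u v ^+ 2 <= dotv u u * dotv v v.
Proof.
have [v0|vn0] := eqVneq (dotv v v) 0.
  by rewrite dotv_eq0 // v0 expr0n mulr0.
have vgt0 : 0 < dotv v v by rewrite lt_neqAle eq_sym vn0 dotv_ge0.
have := dotv_ge0 (dotv v v *: u - dotv u v *: v).
rewrite !dotvE (dotvC v u) => h.
rewrite -subr_ge0 -(pmulr_rge0 _ vgt0); apply: le_trans h _.
by rewrite le_eqVlt; apply/orP; left; apply/eqP; ring.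
Qed.

Lemma sqr_normv u : normv u ^+ 2 = dotv u u.
Proof. by rewrite sqr_sqrtr// dotv_ge0. Qed.

Lemma normv_le_dotv u (B : R) : normv u <= B -> dotv u u <= B ^+ 2.
Proof.
move=> uB; rewrite -sqr_normv lerXn2r// ?nnegrE ?sqrtr_ge0//.
by apply: le_trans uB; rewrite sqrtr_ge0.
Qed.

Lemma normv_eq1 u : normv u = 1 -> dotv u u = 1.
Proof. by move=> h; rewrite -sqr_normv h expr1n. Qed.

Lemma dotv_mulmx (A : 'M[R]_p) u v :
  dotv u (A *m v) = \sum_i \sum_j A i j * (u i 0 * v j 0).
Proof.
apply: eq_bigr => i _; rewrite mxE mulr_sumr; apply: eq_bigr => j _.
by rewrite mulrCA.
Qed.

Lemma dotv_trmx (A : 'M[R]_p) u v : dotv u (A *m v) = dotv (A^T *m u) v.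
Proof.
rewrite dotv_mulmx exchange_big/=; apply: eq_bigr => j _.
rewrite mxE mulr_suml; apply: eq_bigr => i _; rewrite mxE; ring.
Qed.

End DotProduct.

(** * Spectral decomposition and the eigengap inequality *)

Section Spectral.
Context {R : realType} {p : nat}.
Variables (Sigma U : 'M[R]_p) (lam : nat -> R) (v1 : 'cV[R]_p).
Hypotheses (p2 : (2 <= p)%N) (UU : U^T *m U = 1%:M).
Hypothesis SigmaE : Sigma = U *m diag_mx (\row_(i < p) lam i) *m U^T.
Hypothesis lam_noninc : forall i j : nat, (i <= j < p)%N -> lam j <= lam i.
Hypothesis gap : lam 1%N < lam 0%N.
Hypotheses (v11 : dotv v1 v1 = 1) (Sv1 : Sigma *m v1 = lam 0%N *: v1).

Lemma dotv_orthogonal u v : dotv (U^T *m u) (U^T *m v) = dotv u v.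
Proof.
have UU' : U *m U^T = 1%:M by apply: mulmx1C.
by rewrite dotv_trmx trmxK mulmxA UU' mul1mx.
Qed.

Lemma quad_form_spectral v :
  dotv v (Sigma *m v) = \sum_(i < p) lam i * (U^T *m v) i 0 ^+ 2.
Proof.
rewrite SigmaE -!mulmxA dotv_trmx; apply: eq_bigr => i _.
by rewrite mul_diag_mx [in X in _ * X]mxE [(\row__ _) _ _]mxE; ring.
Qed.

Let o0 : 'I_p := Ordinal (ltn_trans (ltnSn 0) p2).
Let o1 : 'I_p := Ordinal p2.

(** In the eigenbasis the eigenvector equation reads [(lam i - lam 0) * (U^T *m v1) i = 0], and
    [lam i <= lam 1 < lam 0] off the first index. So [v1] is the first column of [U] up to sign. *)
Lemma top_eigvec_coord i : i != o0 -> (U^T *m v1) i 0 = 0.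
Proof.
move=> i0.
have /(congr1 (fun m => (U^T *m m) i 0)) := Sv1.
rewrite SigmaE -!mulmxA mulmxA UU mul1mx -scalemxAr.
rewrite mul_diag_mx [LHS]mxE [RHS]mxE mxE => /eqP.
rewrite -subr_eq0 -mulrBl mulf_eq0 => /orP[|/eqP//].
rewrite subr_eq0 => /eqP h.
have : lam i <= lam 1%N.
  by apply: lam_noninc; rewrite ltn_ord andbT lt0n.
by rewrite h leNgt gap.
Qed.

(** The sign of [v1] relative to the first column of [U] is undetermined, hence the squares. *)
Lemma sqr_dotv_top v : dotv v v1 ^+ 2 = (U^T *m v) o0 0 ^+ 2.
Proof.
have E w : dotv w v1 = (U^T *m w) o0 0 * (U^T *m v1) o0 0.
  rewrite -dotv_orthogonal /dotv (bigD1 o0)//= big1 ?addr0// => i i0.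
  by rewrite top_eigvec_coord// mulr0.
by rewrite E exprMn [X in _ * X]expr2 -E v11 mulr1.
Qed.

Lemma quad_form_gap v :
  dotv v (Sigma *m v) <= lam 0%N * dotv v v1 ^+ 2 +
                         lam 1%N * (dotv v v - dotv v v1 ^+ 2).
Proof.
rewrite quad_form_spectral sqr_dotv_top -(dotv_orthogonal v v).
have D (F : 'I_p -> R) : \sum_i F i = F o0 + \sum_(i | i != o0) F i.
  by rewrite (bigD1 o0).
rewrite /dotv !D/= -expr2 [X in lam 1%N * X]addrAC subrr add0r.
rewrite lerD2l mulr_sumr ler_sum// => i i0.
rewrite -expr2 ler_wpM2r ?sqr_ge0//.
by apply: lam_noninc; rewrite ltn_ord andbT lt0n.
Qed.

(** The second column of [U] is the witness. Once the form is read as a second moment, this gives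
    [0 <= lam 1] and so [rho <= lam 0]. *)
Lemma second_eigval_form : exists v : 'cV[R]_p, dotv v (Sigma *m v) = lam 1%N.
Proof.
exists (col o1 U).
rewrite quad_form_spectral colE mulmxA UU mul1mx (bigD1 o1)//= big1 => [|i i1].
  by rewrite mxE !eqxx expr1n mulr1 addr0.
by rewrite mxE (negbTE i1) expr0n mulr0.
Qed.

Lemma top_eigval_form : dotv v1 (Sigma *m v1) = lam 0%N.
Proof. by rewrite Sv1 dotvZr v11 mulr1. Qed.

End Spectral.

(** * One Krasulina-Oja update, deterministically *)

Section KrasulinaOjaStep.
Context {R : realType} {p : nat}.
Variables (v1 : 'cV[R]_p) (B : R).
Hypothesis v11 : dotv v1 v1 = 1.
Implicit Types v x : 'cV[R]_p.

(* A single update changes [sin2] by [-2 eta drift] to first order in [eta]. *)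
Definition drift v x : R :=
  dotv v v1 * dotv x v * (dotv x v1 - dotv x v * dotv v v1 / dotv v v)
  / dotv v v.

(** Matrix of the quadratic form [drift v] in [x]. Its entries depend on the current vector only, so
    averaging over a new sample just brings in the entries of [Sigma]. *)
Definition drift_coef v (i j : 'I_p) : R :=
  dotv v v1 / dotv v v * (v i 0 * v1 j 0)
  - (dotv v v1 / dotv v v) ^+ 2 * (v i 0 * v j 0).

(** Convertible to the recursive clause of [KOiter]. *)
Definition KOstep (eta : R) x v : 'cV[R]_p :=
  v + (eta * dotv x v) *: (x - (dotv x v / dotv v v) *: v).

Lemma sin2E v : sin2 v v1 = 1 - dotv v v1 ^+ 2 / dotv v v.
Proof. by rewrite /sin2 v11 mulr1. Qed.

Lemma sin2_ge0 v : 0 <= sin2 v v1.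
Proof.
(* At [v = 0] the convention [0^-1 = 0] makes the value 1. *)
rewrite sin2E; have [->|vn0] := eqVneq (dotv v v) 0.
  by rewrite invr0 mulr0 subr0.
have vgt0 : 0 < dotv v v by rewrite lt_neqAle eq_sym vn0 dotv_ge0.
rewrite subr_ge0 ler_pdivrMr// mul1r.
by have := dotv_CauchySchwarz v v1; rewrite v11 mulr1.
Qed.

Lemma sin2_le1 v : sin2 v v1 <= 1.
Proof. by rewrite sin2E gerBl divr_ge0 ?sqr_ge0 ?dotv_ge0. Qed.

Lemma driftE v x :
  drift v x = \sum_i \sum_j x i 0 * x j 0 * drift_coef v i j.
Proof.
transitivity (dotv v v1 / dotv v v * (dotv x v * dotv x v1) -
  (dotv v v1 / dotv v v) ^+ 2 * (dotv x v * dotv x v)).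
  by rewrite /drift; ring.
have E a b : dotv x a * dotv x b =
    \sum_i \sum_j x i 0 * x j 0 * (a i 0 * b j 0).
  rewrite [LHS]mulr_suml; apply: eq_bigr => i _; rewrite mulr_sumr.
  by apply: eq_bigr => j _; ring.
rewrite !E !mulr_sumr -sumrB; apply: eq_bigr => i _.
rewrite !mulr_sumr -sumrB; apply: eq_bigr => j _.
by rewrite /drift_coef; ring.
Qed.

Section NonzeroIterate.
Variable v : 'cV[R]_p.
Hypothesis vgt0 : 0 < dotv v v.
Let N := dotv v v.
Let c := dotv v v1.
Let Nn0 : N != 0. Proof. by rewrite gt_eqF. Qed.

Lemma sqr_dotv_le_normv : c ^+ 2 / N <= 1.
Proof. by have := sin2_ge0 v; rewrite sin2E subr_ge0. Qed.

(** Serves integrability: both products split into factors of modulus at most 1. *)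
Lemma drift_coef_bounded i j : `|drift_coef v i j| <= 2.
Proof.
have [le_c2 le_v1 le_vi le_vj] : [/\ c ^+ 2 <= N, v1 j 0 ^+ 2 <= 1,
    v i 0 ^+ 2 <= N & v j 0 ^+ 2 <= N].
  split; [|by rewrite -v11; exact: sqr_coord_le_dotv
    | exact: sqr_coord_le_dotv | exact: sqr_coord_le_dotv].
  by have := sqr_dotv_le_normv; rewrite ler_pdivrMr// mul1r.
have sq1 (a : R) : a ^+ 2 <= 1 -> `|a| <= 1.
  by move=> h; rewrite -(expr_le1 (n := 2))// real_normK ?num_real.
have mul1 (a b : R) : a ^+ 2 <= N -> b ^+ 2 <= N -> `|a * b / N| <= 1.
  move=> ha hb; apply: sq1.
  rewrite expr_div_n ler_pdivrMr ?exprn_gt0// mul1r exprMn [N ^+ 2]expr2.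
  by rewrite ler_pM ?sqr_ge0.
rewrite /drift_coef -/N -/c.
have -> : c / N * (v i 0 * v1 j 0) - (c / N) ^+ 2 * (v i 0 * v j 0) =
  (c * v i 0 / N) * v1 j 0 - (c * v i 0 / N) * (c * v j 0 / N) by ring.
apply: le_trans (ler_normB _ _) _; rewrite !normrM -!normrM.
rewrite (_ : 2 = 1 + 1 :> R)//; apply: lerD; rewrite normrM mulr_ile1//.
- exact: mul1.
- exact: sq1.
- exact: mul1.
- exact: mul1.
Qed.

Section BoundedInput.
Variable x : 'cV[R]_p.
Hypothesis xB : dotv x x <= B ^+ 2.
Let y := dotv x v.
(** Squared norm of the component of [x] orthogonal to [v]. *)
Let w2 := dotv x x - y ^+ 2 / N.

Let w2_ge0 : 0 <= w2.
Proof.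
rewrite subr_ge0 ler_pdivrMr//; exact: dotv_CauchySchwarz.
Qed.

(** Pythagoras: the increment is orthogonal to [v]. In particular norms never decrease. *)
Lemma dotv_KOstep eta :
  dotv (KOstep eta x v) (KOstep eta x v) = N + (eta * y) ^+ 2 * w2.
Proof.
rewrite /KOstep !dotvE (dotvC v x) -/N -/y /w2.
by field.
Qed.

Lemma dotv_KOstep_ge eta : N <= dotv (KOstep eta x v) (KOstep eta x v).
Proof. by rewrite dotv_KOstep lerDl mulr_ge0// sqr_ge0. Qed.

(** With [q = y ^+ 2 / N] and [s] the squared norm of [x], this is [q * (s - q) <= s ^+ 2 / 4]. *)
Let yw_le : y ^+ 2 / N * w2 <= B ^+ 4 / 4.
Proof.
have q0 : 0 <= y ^+ 2 / N by rewrite divr_ge0 ?sqr_ge0// ltW.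
rewrite /w2; set q := y ^+ 2 / N in q0 *; set s := dotv x x; have sB : s <= B ^+ 2 := xB.
have s0 : 0 <= s by exact: dotv_ge0.
have -> : B ^+ 4 = (B ^+ 2) ^+ 2 by rewrite -exprM.
have : s ^+ 2 <= (B ^+ 2) ^+ 2 by rewrite lerXn2r// nnegrE ?sqr_ge0.
have := sqr_ge0 (s - 2 * q).
nra.
Qed.

(** The numerator of [sin2] after the update is nonnegative, so its denominator may be lowered to
    [N]. What remains is an exact expansion in [eta], from which the negative square
    [- (eta * y * g) ^+ 2 / N] is dropped. *)
Lemma sin2_KOstep eta :
  sin2 (KOstep eta x v) v1 <=
    sin2 v v1 - 2 * eta * drift v x + eta ^+ 2 * (B ^+ 4 / 4).
Proof.
rewrite !sin2E; set v' := KOstep eta x v.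
have N'N : N <= dotv v' v' by exact: dotv_KOstep_ge.
have N'0 : 0 < dotv v' v' by apply: lt_le_trans N'N.
have CS : dotv v' v1 ^+ 2 <= dotv v' v'.
  by have := dotv_CauchySchwarz v' v1; rewrite v11 mulr1.
have -> : 1 - dotv v' v1 ^+ 2 / dotv v' v' =
  (dotv v' v' - dotv v' v1 ^+ 2) / dotv v' v' by field; rewrite gt_eqF.
apply: (@le_trans _ _ ((dotv v' v' - dotv v' v1 ^+ 2) / N)).
  by rewrite ler_wpM2l ?subr_ge0// lef_pV2.
have c'E : dotv v' v1 = c + eta * y * (dotv x v1 - y * c / N).
  by rewrite /v' /KOstep !dotvE -/c -/y -/N; ring.
rewrite dotv_KOstep c'E /drift -/N -/c -/y.
set g := dotv x v1 - y * c / N.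
have -> : (N + (eta * y) ^+ 2 * w2 - (c + eta * y * g) ^+ 2) / N =
  1 - c ^+ 2 / N - 2 * eta * (c * y * g / N) + eta ^+ 2 * (y ^+ 2 / N * w2)
   - (eta * y * g) ^+ 2 / N by field.
have h1 : 0 <= (eta * y * g) ^+ 2 / N by rewrite divr_ge0 ?sqr_ge0 ?ltW.
have h2 : eta ^+ 2 * (y ^+ 2 / N * w2) <= eta ^+ 2 * (B ^+ 4 / 4).
  by rewrite ler_wpM2l ?sqr_ge0.
lra.
Qed.

(** The last factor of [drift] pairs the components of [x] and [v1] orthogonal to [v], so
    Cauchy-Schwarz produces [sin2 v v1]. The noise thus fades near the target, which the exponential
    estimate relies on. *)
Lemma sqr_drift_le : drift v x ^+ 2 <= B ^+ 4 / 4 * sin2 v v1.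
Proof.
have S0 := sin2_ge0 v; have c1 := sqr_dotv_le_normv.
have gw : (dotv x v1 - y * c / N) ^+ 2 <= w2 * sin2 v v1.
  have := dotv_CauchySchwarz (x - (y / N) *: v) (v1 - (c / N) *: v).
  rewrite !dotvE (dotvC v x) (dotvC v1 v) v11 -/N -/c -/y sin2E -/N -/c.
  rewrite (_ : dotv x v1 + _ + _ = dotv x v1 - y * c / N); last by field.
  rewrite (_ : dotv x x + _ + _ = w2); last by rewrite /w2; field.
  by rewrite (_ : 1 + _ + _ = 1 - c ^+ 2 / N); last by field.
rewrite /drift -/N -/c -/y; set g := dotv x v1 - y * c / N in gw *.
have -> : (c * y * g / N) ^+ 2 = c ^+ 2 / N * (y ^+ 2 / N * g ^+ 2) by field.
have q0 : 0 <= y ^+ 2 / N by rewrite divr_ge0 ?sqr_ge0// ltW.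
apply: (@le_trans _ _ (y ^+ 2 / N * g ^+ 2)).
  by rewrite ler_piMl// mulr_ge0// sqr_ge0.
apply: (@le_trans _ _ (y ^+ 2 / N * (w2 * sin2 v v1))).
  by rewrite ler_wpM2l.
by rewrite mulrA ler_wpM2r.
Qed.

End BoundedInput.

(** Averaging turns the drift into [c / N * (l0 * c) - (c / N) ^+ 2 * dotv v (Sigma *m v)]. The gap
    bound controls the subtracted form, and [c ^+ 2 / N = 1 - sin2 v v1]. *)
Lemma mean_drift_ge (Sigma : 'M[R]_p) (l0 l1 : R) :
  Sigma *m v1 = l0 *: v1 ->
  dotv v (Sigma *m v) <= l0 * c ^+ 2 + l1 * (N - c ^+ 2) ->
  (l0 - l1) * sin2 v v1 * (1 - sin2 v v1) <=
    \sum_i \sum_j Sigma i j * drift_coef v i j.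
Proof.
move=> Sv1 gap.
have -> : \sum_i \sum_j Sigma i j * drift_coef v i j =
    c / N * dotv v (Sigma *m v1) - (c / N) ^+ 2 * dotv v (Sigma *m v).
  rewrite !dotv_mulmx !mulr_sumr -sumrB; apply: eq_bigr => i _.
  rewrite !mulr_sumr -sumrB; apply: eq_bigr => j _.
  by rewrite /drift_coef -/N -/c; ring.
rewrite Sv1 dotvZr -/c sin2E -/c -/N.
have -> : (l0 - l1) * (1 - c ^+ 2 / N) * (1 - (1 - c ^+ 2 / N)) =
    c / N * (l0 * c) - (c / N) ^+ 2 * (l0 * c ^+ 2 + l1 * (N - c ^+ 2)).
  by field.
by rewrite lerD2l lerN2 ler_wpM2l ?sqr_ge0.
Qed.

End NonzeroIterate.
End KrasulinaOjaStep.

(** * Elementary inequalities for the exponential and the logarithm *)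

Section ExpLogBounds.
Context {R : realType}.
Implicit Types s z x m : R.

(** Squaring [exp (z/2) <= 1 / (1 - z/2)] leaves [1 <= (1 + z + z^2) * (1 - z/2)^2], whose right
    side is [1 + z^2 * (1 - 3 z + z^2) / 4]. *)
Lemma expR_le_quad z : z <= 1 / 4 -> expR z <= 1 + z + z ^+ 2.
Proof.
move=> z14.
have h : expR (z / 2) * (1 - z / 2) <= 1.
  have := expR_ge1Dx (- (z / 2)); rewrite expRN => h.
  by rewrite mulrC -ler_pdivlMr ?expR_gt0// mul1r.
have e2 : expR z = expR (z / 2) ^+ 2.
  by rewrite expr2 -expRD; congr expR; field.
have e0 := expR_gt0 (z / 2).
rewrite e2; set e := expR (z / 2) in h e0 *.
have h2 : e ^+ 2 * (1 - z / 2) ^+ 2 <= 1.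
  by rewrite -exprMn expr_le1// mulr_ge0 ?ltW//; lra.
have d0 : 0 < (1 - z / 2) ^+ 2 by rewrite exprn_gt0//; lra.
rewrite -(ler_pM2r d0); apply: le_trans h2 _.
nra.
Qed.

(** One step of [W], with [m] for [n t.+1] and [s] for [theta * S t]. Since
    [1 - 3/2 s <= exp (- 3/2 s)], the exponent becomes [(m - 1) s + (1 / (8 m) - s / 2)], and only a
    positive bracket costs anything. *)
Lemma expR_contraction s m : 0 <= s -> 1 < m ->
  expR (m * s + 1 / (8 * m)) * (1 - 2 * s + s / 2) <= expR ((m - 1) * s) + 1 / m.
Proof.
move=> s0 m1; have mi : 0 < m^-1 by rewrite invr_gt0; lra.
have mi1 : m^-1 <= 1 by rewrite invf_le1; lra.
have mm : m * m^-1 = 1 by rewrite mulfV// gt_eqF//; lra.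
rewrite div1r invfM; set u := m^-1 in mi mi1 mm *.
have h1 : 1 - 2 * s + s / 2 <= expR (- (3 / 2 * s)).
  by have := expR_ge1Dx (- (3 / 2 * s)); lra.
apply: le_trans (ler_wpM2l (expR_ge0 _) h1) _; rewrite -expRD.
have -> : m * s + 8^-1 * u + - (3 / 2 * s) = (m - 1) * s + (8^-1 * u - s / 2).
  by field.
have [q0|q0] := leP (8^-1 * u - s / 2) 0.
  apply: (@le_trans _ _ (expR ((m - 1) * s))); first by rewrite ler_expR; lra.
  by rewrite lerDl mul1r ltW.
(* A positive bracket forces [s < 1 / (4 m)], so [(m - 1) s <= 1/4] and the excess is at most
   [2 * exp (1/4) / (8 m)], below [1 / m]. *)
have xs : (m - 1) * s <= 1 / 4 by nra.
have x0 : 0 <= (m - 1) * s by nra.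
rewrite expRD; have := expR_le_quad xs; have := expR_ge0 ((m - 1) * s).
have : expR (8^-1 * u - s / 2) <= 1 + 2 * (8^-1 * u - s / 2).
  apply: le_trans (expR_le_quad _) _; nra.
have := expR_ge0 (8^-1 * u - s / 2).
nra.
Qed.

(** This is [- ln (1 - 1/m) >= 1/m]; it gives the growth of the weight [a] per step. *)
Lemma ln_incr_ge m : 1 < m -> m^-1 <= ln (m / (m - 1)).
Proof.
move=> m1; have mi : 0 < m^-1 by rewrite invr_gt0; lra.
have := @le_ln1Dx R (- m^-1).
rewrite (_ : 1 - m^-1 = (m / (m - 1))^-1); last by field; rewrite !gt_eqF//; lra.
have r0 : 0 < m / (m - 1) by apply: divr_gt0; lra.
rewrite lnV ?posrE// lerN2; apply; rewrite ltrN2 invf_lt1; lra.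
Qed.

(** The fall of [1/a] pays for the extra [1/m]: [1/a - 1/b = (b - a) / (a b)], with [b - a >= 1/m]
    and [a <= b]. *)
Lemma weight_telescope (w a b m : R) : 0 <= w -> 1 <= a -> a + m^-1 <= b -> 0 < m ->
  (w + 1 / m) / b ^+ 2 + b^-1 <= w / a ^+ 2 + a^-1.
Proof.
move=> w0 a1 ab m0; have mi : 0 < m^-1 by rewrite invr_gt0.
have a0 : 0 < a by lra. have b0 : 0 < b by lra.
have h1 : w / b ^+ 2 <= w / a ^+ 2.
  rewrite ler_wpM2l// lef_pV2 ?posrE ?exprn_gt0// lerXn2r ?nnegrE; lra.
have h2 : m^-1 / b ^+ 2 <= a^-1 - b^-1.
  have -> : a^-1 - b^-1 = (b - a) * b / a / b ^+ 2.
    by field; rewrite !gt_eqF.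
  rewrite ler_wpM2r ?invr_ge0 ?sqr_ge0// ler_pdivlMr//.
  nra.
rewrite mulrDl mul1r; lra.
Qed.

End ExpLogBounds.

(** * Measurability of the iterates *)

Section Measurability.
Context {d : measure_display} {T : measurableType d} {R : realType}.
Implicit Types f g : T -> R.

Lemma measurable_fun_inv f : measurable_fun setT f ->
  measurable_fun setT (fun w => (f w)^-1).
Proof.
move=> mf.
(* [powR] with exponent -1 is the inverse only on nonnegative numbers, hence [f ^+ 2]; at a zero of
   [f] both sides are 0. *)
have -> : (fun w => (f w)^-1) = (fun w => f w * ((f w ^+ 2) `^ (-1))).
  apply/funext => w; rewrite powR_inv1 ?sqr_ge0//.
  have [->|f0] := eqVneq (f w) 0; first by rewrite invr0 mul0r.
  by field.
apply: measurable_funM => //.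
apply: (measurableT_comp (measurable_powR (-1))).
exact: measurable_funX.
Qed.

Lemma measurable_fun_div f g : measurable_fun setT f -> measurable_fun setT g ->
  measurable_fun setT (fun w => f w / g w).
Proof. by move=> mf mg; apply: measurable_funM => //; exact: measurable_fun_inv. Qed.

Lemma measurable_bool_set (b : T -> bool) :
  measurable_fun setT b -> measurable [set w | b w].
Proof.
move=> mb; rewrite -[X in measurable X]setTI; exact: (mb measurableT [set true]).
Qed.

Lemma measurable_dotv p (u v : T -> 'cV[R]_p) :
  random_vec u -> random_vec v -> measurable_fun setT (fun w => dotv (u w) (v w)).
Proof.
move=> mu mv; rewrite /dotv; apply: measurable_sum => i.
exact: measurable_funM.
Qed.

Lemma measurable_sin2 p (u v : T -> 'cV[R]_p) :
  random_vec u -> random_vec v -> measurable_fun setT (fun w => sin2 (u w) (v w)).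
Proof.
move=> mu mv; apply: measurable_funB; first exact: measurable_cst.
apply: measurable_fun_div; first by apply: measurable_funX; exact: measurable_dotv.
by apply: measurable_funM; exact: measurable_dotv.
Qed.

Lemma random_vec_cst p (u : 'cV[R]_p) : random_vec (fun _ : T => u).
Proof. by move=> i; exact: measurable_cst. Qed.

Lemma random_vec_KOiter p (v0 : T -> 'cV[R]_p) X eta t :
  random_vec v0 -> (forall k, (1 <= k <= t)%N -> random_vec (X k)) ->
  random_vec (KOiter v0 X eta t).
Proof.
move=> mv0; elim: t => [//|t IH] mX /=.
have mv : random_vec (KOiter v0 X eta t).
  by apply: IH => k /andP[k1 kt]; apply: mX; rewrite k1 (leq_trans kt).
have mx : random_vec (X t.+1) by apply: mX; rewrite leqnn.
have my := measurable_dotv mx mv.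
move=> i; under eq_fun do rewrite !mxE.
apply: measurable_funD; first exact: mv.
apply: measurable_funM; first by apply: measurable_funM => //; exact: measurable_cst.
apply: measurable_funB; first exact: mx.
apply: measurable_funM; last exact: mv.
by apply: measurable_fun_div => //; exact: measurable_dotv.
Qed.

End Measurability.

(** * Expectation of bounded random variables *)

Section BoundedExpectation.
Context {d : measure_display} {T : measurableType d} {R : realType}.
Variable P : probability T R.

(** Bounded at every point, so that products stay integrable. The sigma-algebra is the one carried
    by [T], so the same predicate also expresses dependence on the past. *)
Definition bounded_rv (f : T -> R) :=
  measurable_fun setT f /\ exists M, forall w, `|f w| <= M.

Lemma bounded_rv_integrable f : bounded_rv f -> P.-integrable setT (EFin \o f).
Proof.
move=> [mf [M fM]]; apply: measurable_bounded_integrable => //.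
  by rewrite [X in (X < _)%E]probability_setT ltry.
exists M; split; first exact: num_real.
by move=> N MN w _; apply: le_trans (fM w) (ltW MN).
Qed.

Lemma bounded_rv_cst c : bounded_rv (fun _ => c).
Proof. by split; [exact: measurable_cst | exists `|c|]. Qed.

Lemma bounded_rvD f g : bounded_rv f -> bounded_rv g -> bounded_rv (fun w => f w + g w).
Proof.
move=> [mf [M fM]] [mg [N gN]]; split; first exact: measurable_funD.
by exists (M + N) => w; apply: le_trans (ler_normD _ _) _; exact: lerD.
Qed.

Lemma bounded_rvM f g : bounded_rv f -> bounded_rv g -> bounded_rv (fun w => f w * g w).
Proof.
move=> [mf [M fM]] [mg [N gN]]; split; first exact: measurable_funM.
by exists (M * N) => w; rewrite normrM ler_pM.
Qed.

Lemma bounded_rv_bool (b : T -> bool) : measurable_fun setT b ->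
  bounded_rv (fun w => (b w)%:R).
Proof.
move=> mb; split; last by exists 1 => w; case: (b w); rewrite ?normr1 ?normr0.
have -> : (fun w => (b w)%:R) = (fun w => if b w then 1 else 0 : R).
  by apply/funext => w; case: (b w).
by apply: measurable_fun_ifT => //; exact: measurable_cst.
Qed.

Lemma expectD f g : bounded_rv f -> bounded_rv g ->
  \int[P]_w (f w + g w) = \int[P]_w f w + \int[P]_w g w.
Proof. by move=> bf bg; apply: RintegralD => //; exact: bounded_rv_integrable. Qed.

Lemma expectZ c f : bounded_rv f -> \int[P]_w (c * f w) = c * \int[P]_w f w.
Proof. by move=> bf; apply: RintegralZl => //; exact: bounded_rv_integrable. Qed.

Lemma expect_cst c : \int[P]_w c = c.
Proof.
have := @Rintegral_cst _ _ _ P setT measurableT c => /= ->.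
by rewrite [P _]probability_setT mulr1.
Qed.

Lemma le_expect f g : bounded_rv f -> bounded_rv g -> (forall w, f w <= g w) ->
  \int[P]_w f w <= \int[P]_w g w.
Proof. by move=> bf bg fg; apply: le_Rintegral => //; exact: bounded_rv_integrable. Qed.

Lemma bounded_rv_sum (I : Type) (r : seq I) (F : I -> T -> R) :
  (forall i, bounded_rv (F i)) -> bounded_rv (fun w => \sum_(i <- r) F i w).
Proof.
move=> bF; elim: r => [|i r IH].
  by under eq_fun do rewrite big_nil; exact: bounded_rv_cst.
by under eq_fun do rewrite big_cons; exact: bounded_rvD.
Qed.

Lemma expect_sum (I : Type) (r : seq I) (F : I -> T -> R) :
  (forall i, bounded_rv (F i)) ->
  \int[P]_w (\sum_(i <- r) F i w) = \sum_(i <- r) \int[P]_w F i w.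
Proof.
move=> bF; elim: r => [|i r IH].
  under [LHS]eq_Rintegral do rewrite big_nil.
  by rewrite expect_cst big_nil.
under [LHS]eq_Rintegral do rewrite big_cons.
by rewrite expectD// ?IH ?big_cons//; exact: bounded_rv_sum.
Qed.

Lemma expect_bool (b : T -> bool) : measurable_fun setT b ->
  \int[P]_w (b w)%:R = fine (P [set w | b w]).
Proof.
move=> mb; have mB := measurable_bool_set mb.
rewrite /Rintegral -[X in fine (P X)]setIT -integral_indic//.
congr fine; apply: eq_integral => w _; rewrite /= indicE; congr (_%:R%:E).
by case: (boolP (b w)) => bw; [rewrite mem_set | rewrite memNset//=; exact/negP].
Qed.

End BoundedExpectation.

(** * Ville's maximal inequality *)

Section Ville.
Context {d : measure_display} {T : measurableType d} {R : realType}.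
Variables (P : probability T R) (E0 : T -> bool) (G : nat -> T -> R) (K g : R).

(* [alive t] constrains [G s] for [s < t] only, so that [alive t.+1] depends on
   the past up to time [t]. *)
Fixpoint alive (t : nat) (w : T) : bool :=
  if t is t'.+1 then alive t' w && (G t' w < K) else E0 w.

Hypotheses (K0 : 0 < K) (mE0 : measurable_fun setT E0).
Hypothesis bG : forall t, bounded_rv (G t).
Hypothesis G0 : forall w, E0 w -> G 0%N w <= g.
Hypothesis g0 : 0 <= g.
Hypothesis superG : forall t,
  \int[P]_w ((alive t.+1 w)%:R * G t.+1 w) <= \int[P]_w ((alive t.+1 w)%:R * G t w).

Lemma measurable_alive t : measurable_fun setT (alive t).
Proof.
elim: t => [//|t IH] /=; apply: measurable_and => //.
apply: measurable_fun_ltr; first by case: (bG t).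
exact: measurable_cst.
Qed.

Let balive t : bounded_rv (fun w => (alive t w)%:R : R).
Proof. exact/bounded_rv_bool/measurable_alive. Qed.

Let balG t s : bounded_rv (fun w => (alive t w)%:R * G s w).
Proof. exact: bounded_rvM. Qed.

(** Optional stopping by bookkeeping: a path lost between [alive t] and [alive t.+1] has [G t >= K],
    so what the integral of [G t] loses covers [K] times the lost probability. *)
Lemma expect_alive t :
  \int[P]_w ((alive t w)%:R * G t w) + K * \int[P]_w (E0 w)%:R
    <= g + K * \int[P]_w (alive t w)%:R.
Proof.
elim: t => [|t IH].
  rewrite lerD2r -[leRHS](expect_cst P); apply: le_expect => //.
  - exact: bounded_rv_cst.
  - by move=> w /=; case: (boolP (E0 w)) => [/G0|_]; rewrite ?mul1r ?mul0r.
apply: le_trans (lerD (superG t) (lexx _)) _.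
have : \int[P]_w ((alive t.+1 w)%:R * G t w) + K * \int[P]_w (alive t w)%:R
   <= \int[P]_w ((alive t w)%:R * G t w) + K * \int[P]_w (alive t.+1 w)%:R.
  rewrite -!expectZ// -!expectD//; try exact: bounded_rvM (bounded_rv_cst _) _.
  apply: le_expect; try by apply: bounded_rvD => //;
    exact: bounded_rvM (bounded_rv_cst _) _.
  move=> w /=; case: (alive t w) => /=; last by rewrite !mul0r.
  by case: ltP => h /=; rewrite ?mul1r ?mul0r ?mulr1 ?mulr0; lra.
move: IH; lra.
Qed.

Hypothesis G_ge0 : forall t w, 0 <= G t w.

(** The bound from [expect_alive] is uniform in [t], and the sets of survivors decrease, so
    continuity from above applies. *)
Lemma Ville_bound :
  ((fine (P [set w | E0 w]) - g / K)%:E <= P [set w | forall t, alive t w])%E.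
Proof.
have mA t : measurable [set w | alive t w] by exact/measurable_bool_set/measurable_alive.
have -> : [set w | forall t, alive t w] = \bigcap_t [set w | alive t w].
  by apply/seteqP; split => [w h t _|w h t]; [exact: h | exact: (h t I)].
have mono : {homo (fun t => [set w | alive t w]) : n m / (n <= m)%N >-> (n >= m)%O}.
  apply/nonincreasing_seqP => t; apply/subsetPset => w /= /andP[].
  by [].
have cv := @nonincreasing_cvg_mu _ _ _ P (fun t => [set w | alive t w]) _ mA
  (bigcapT_measurable mA) mono.
have {}cv := cv (le_lt_trans (probability_le1 P (mA 0%N)) (ltry 1)).
rewrite -(cvg_lim _ cv)//; apply: lime_ge; first by apply/cvg_ex; eexists; exact: cv.
apply: nearW => t /=.
have fin : P [set w | alive t w] \is a fin_num by exact: fin_num_measure.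
rewrite -(fineK fin) lee_fin -!expect_bool//; last exact: measurable_alive.
have h := expect_alive t.
have : 0 <= \int[P]_w ((alive t w)%:R * G t w).
  by apply: Rintegral_ge0 => w _; rewrite mulr_ge0.
move=> h0; rewrite lerBlDr -lerBlDl ler_pdivlMr//; move: h h0; nra.
Qed.

End Ville.

(** * The supermartingale built from the iterates *)

Section Supermartingale.
Context {R : realType} {d : measure_display} {T : measurableType d}.
Variables (P : probability T R) (p : nat).
Variables (X : nat -> T -> 'cV[R]_p) (v0 : T -> 'cV[R]_p).
Variables (Sigma : 'M[R]_p) (v1 : 'cV[R]_p) (B l0 l1 L K : R).
(** Generators of the past up to time [t]; measurability over [g_sigma_algebraType (hist t)] encodes
    being a function of that past. *)
Variable hist : nat -> set (set T).

Let rho := l0 - l1.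
Let eta := fun t : nat => 2 / (rho * (t%:R + L)).
Let beta := B ^+ 2 / rho.
Let theta := (8 * beta ^+ 2)^-1.
Let V := KOiter v0 X eta.
Let S t w := sin2 (V t w) v1.

Hypothesis v11 : dotv v1 v1 = 1.
Hypothesis Sv1 : Sigma *m v1 = l0 *: v1.
Hypothesis gapSigma : forall v, dotv v (Sigma *m v) <=
  l0 * dotv v v1 ^+ 2 + l1 * (dotv v v - dotv v v1 ^+ 2).
Hypotheses (rho0 : 0 < rho) (beta1 : 1 <= beta) (L1 : 1 <= L).
Hypothesis v01 : forall w, dotv (v0 w) (v0 w) = 1.
Hypothesis XB : forall t w, dotv (X t.+1 w) (X t.+1 w) <= B ^+ 2.
Hypothesis mX : forall t, random_vec (X t.+1).
Hypothesis hist_measurable : forall t, hist t `<=` measurable.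
Hypothesis mv0_hist : forall t,
  random_vec (v0 : g_sigma_algebraType (hist t) -> 'cV[R]_p).
Hypothesis mX_hist : forall k t, (1 <= k <= t)%N ->
  random_vec (X k : g_sigma_algebraType (hist t) -> 'cV[R]_p).
(** Conditional covariance given the past, tested against bounded past variables in place of a
    conditional expectation. *)
Hypothesis mean_hist : forall t (phi : T -> R) (M : R) i j,
  measurable_fun (setT : set (g_sigma_algebraType (hist t))) phi ->
  (forall w, `|phi w| <= M) ->
  \int[P]_w (phi w * (X t.+1 w i 0 * X t.+1 w j 0)) = Sigma i j * \int[P]_w phi w.

Let bounded_past t (phi : T -> R) :=
  @bounded_rv _ (g_sigma_algebraType (hist t)) R phi.

Lemma measurable_past t d' (T' : measurableType d') (f : T -> T') :
  measurable_fun (setT : set (g_sigma_algebraType (hist t))) f ->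
  measurable_fun setT f.
Proof.
move=> mf _ Y mY; have /= h := mf measurableT Y mY.
apply: (smallest_sub _ _ h); last exact: hist_measurable.
by split => [|A mA|F mF];
  [exact: measurable0 | rewrite setTD; exact: measurableC | exact: bigcup_measurable].
Qed.

Lemma bounded_past_rv t phi : bounded_past t phi -> bounded_rv phi.
Proof. by move=> [m b]; split => //; exact: measurable_past m. Qed.

Lemma measurable_iterate_past s t : (s <= t)%N ->
  random_vec (V s : g_sigma_algebraType (hist t) -> 'cV[R]_p).
Proof.
move=> st; apply: random_vec_KOiter => // k /andP[k1 ks].
by apply: mX_hist; rewrite k1 (leq_trans ks).
Qed.

Lemma measurable_sin2_past s t : (s <= t)%N ->
  measurable_fun (setT : set (g_sigma_algebraType (hist t))) (S s).
Proof.
move=> st; apply: measurable_sin2; first exact: measurable_iterate_past.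
exact: random_vec_cst.
Qed.

(** Norms start at 1 and never decrease, so no iterate vanishes. *)
Lemma iterate_norm_ge1 t w : 1 <= dotv (V t w) (V t w).
Proof.
elim: t => [|t IH]; first by rewrite /V/= v01.
apply: (le_trans IH); apply: dotv_KOstep_ge => //.
exact: lt_le_trans ltr01 IH.
Qed.

Let Vgt0 t w : 0 < dotv (V t w) (V t w).
Proof. exact: lt_le_trans ltr01 (iterate_norm_ge1 t w). Qed.

Lemma bounded_drift_coef t i j :
  bounded_past t (fun w => drift_coef v1 (V t w) i j).
Proof.
have mV := measurable_iterate_past (leqnn t).
have mdV := measurable_dotv mV mV.
have mdv1 := measurable_dotv mV (random_vec_cst v1).
split; last by exists 2 => w; exact: drift_coef_bounded.
apply: measurable_funB; apply: measurable_funM.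
- exact: measurable_fun_div.
- by apply: measurable_funM; [exact: mV | exact: measurable_cst].
- by apply: measurable_funX; exact: measurable_fun_div.
- by apply: measurable_funM; exact: mV.
Qed.

Lemma bounded_cov t i j : bounded_rv (fun w => X t.+1 w i 0 * X t.+1 w j 0).
Proof.
have bX k : bounded_rv (fun w => X t.+1 w k 0).
  split; first exact: mX.
  (* Comes from [2 |a| <= a ^+ 2 + 1], which avoids roots and the sign of [B]. *)
  exists (B ^+ 2 + 1) => w; set a := X t.+1 w k 0.
  have : a ^+ 2 <= B ^+ 2 := le_trans (sqr_coord_le_dotv _ _) (XB t w).
  have := sqr_ge0 (a - 1); have := sqr_ge0 (a + 1).
  by rewrite ler_norml; nra.
exact: bounded_rvM.
Qed.

(** Only second moments of the new sample enter, so [mean_hist] applies entry by entry, with [phi]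
    times a coefficient as test variable. *)
Lemma expect_drift t phi : bounded_past t phi ->
  \int[P]_w (phi w * drift v1 (V t w) (X t.+1 w)) =
  \int[P]_w (phi w * \sum_i \sum_j Sigma i j * drift_coef v1 (V t w) i j).
Proof.
move=> bphi; have bc := bounded_drift_coef t.
have bpc i j : bounded_past t (fun w => phi w * drift_coef v1 (V t w) i j).
  exact: bounded_rvM bphi (bc i j).
have bpc' i j := bounded_past_rv (bpc i j).
have b1 i j : bounded_rv (fun w => phi w * drift_coef v1 (V t w) i j *
    (X t.+1 w i 0 * X t.+1 w j 0)).
  by apply: bounded_rvM => //; exact: bounded_cov.
have b2 i j : bounded_rv (fun w => Sigma i j * (phi w * drift_coef v1 (V t w) i j)).
  by apply: bounded_rvM => //; exact: bounded_rv_cst.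
transitivity (\int[P]_w (\sum_i \sum_j
    (phi w * drift_coef v1 (V t w) i j * (X t.+1 w i 0 * X t.+1 w j 0)))).
  apply: eq_Rintegral => w _; rewrite driftE mulr_sumr.
  apply: eq_bigr => i _; rewrite mulr_sumr; apply: eq_bigr => j _; ring.
transitivity (\int[P]_w (\sum_i \sum_j
    (Sigma i j * (phi w * drift_coef v1 (V t w) i j)))); last first.
  apply: eq_Rintegral => w _; rewrite mulr_sumr.
  apply: eq_bigr => i _; rewrite mulr_sumr; apply: eq_bigr => j _; ring.
rewrite !expect_sum; try by move=> i; exact: bounded_rv_sum.
apply: eq_bigr => i _; rewrite !expect_sum//; apply: eq_bigr => j _.
rewrite expectZ//; have [m [M hM]] := bpc i j.
exact: (mean_hist i j m hM).
Qed.

Let S_ge0 t w : 0 <= S t w. Proof. exact: sin2_ge0. Qed.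
Let S_le1 t w : S t w <= 1. Proof. exact: sin2_le1. Qed.

Let beta0 : 0 < beta. Proof. exact: lt_le_trans ltr01 beta1. Qed.

Let theta0 : 0 < theta.
Proof. by rewrite invr_gt0 mulr_gt0// exprn_gt0. Qed.

Let theta_beta : theta * beta ^+ 2 = 1 / 8.
Proof. by rewrite /theta; field; rewrite gt_eqF. Qed.

Let n t : R := t%:R + L.
Let n_ge1 t : 1 <= n t.
Proof. by rewrite /n; have := ler0n R t; have := L1; lra. Qed.

Let L0 : 0 < L. Proof. exact: lt_le_trans ltr01 L1. Qed.

Let W t w := expR (theta * n t * S t w).

(** The step size cancels [n t.+1] in the drift term, [theta * n * 2 * eta = 4 * theta / rho], and
    the quadratic term is [theta * beta ^+ 2 / n = 1 / (8 n)]. *)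
Lemma expW_step t w :
  W t.+1 w <= expR (n t.+1 * (theta * S t w) + 1 / (8 * n t.+1)) *
    (1 - 4 * theta / rho * drift v1 (V t w) (X t.+1 w) + theta * S t w / 2).
Proof.
have m0 : 0 < n t.+1 by exact: lt_le_trans ltr01 (n_ge1 _).
set D := drift v1 (V t w) (X t.+1 w).
set z := - (4 * theta / rho * D).
have Bb : B ^+ 4 = beta ^+ 2 * rho ^+ 2.
  by rewrite /beta; field; rewrite gt_eqF.
(* The choice of [theta] acts here: [z ^+ 2 <= 4 * theta * (theta * beta ^+ 2) * S], where
   [theta * beta ^+ 2 = 1/8]. *)
have z2 : z ^+ 2 <= theta * S t w / 2.
  have -> : z ^+ 2 = (4 * theta / rho) ^+ 2 * D ^+ 2 by rewrite /z; ring.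
  apply: (@le_trans _ _ ((4 * theta / rho) ^+ 2 * (B ^+ 4 / 4 * S t w))).
    rewrite ler_wpM2l ?sqr_ge0//; exact: sqr_drift_le.
  rewrite Bb (_ : _ * _ = 4 * theta * (theta * beta ^+ 2) * S t w); last first.
    by field; rewrite gt_eqF.
  by rewrite theta_beta le_eqVlt; apply/orP; left; apply/eqP; field.
have th8 : theta <= 1 / 8.
  rewrite /theta invfM ler_pdivrMr ?exprn_gt0//.
  have : 1 <= beta ^+ 2 by rewrite exprn_ege1.
  lra.
(* From [z ^+ 2 <= theta * S / 2 <= 1/16]. *)
have z14 : z <= 1 / 4.
  have := S_le1 t w; have := S_ge0 t w; nra.
have step : theta * n t.+1 * S t.+1 w <=
    n t.+1 * (theta * S t w) + z + 1 / (8 * n t.+1).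
  have h : S t.+1 w <= _ := sin2_KOstep v11 (Vgt0 t w) (XB t w) (eta t.+1).
  apply: le_trans (ler_wpM2l _ h) _; first by rewrite mulr_ge0 ?ltW.
  rewrite Bb (_ : 1 / (8 * n t.+1) = theta * beta ^+ 2 / n t.+1); last first.
    by rewrite theta_beta; field; rewrite gt_eqF.
  rewrite /eta -/(n t.+1) /z -/(S t w) -/D.
  rewrite le_eqVlt; apply/orP; left; apply/eqP; field.
  by rewrite !gt_eqF.
rewrite /W; apply: (@le_trans _ _ (expR (n t.+1 * (theta * S t w) + z + 1 / (8 * n t.+1)))).
  by rewrite ler_expR.
rewrite (addrAC _ z) expRD ler_wpM2l ?expR_ge0//.
by apply: le_trans (expR_le_quad z14) _; rewrite -/z; lra.
Qed.

Lemma bounded_exp_past s t a b : (s <= t)%N ->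
  bounded_past t (fun w => expR (a * S s w + b)).
Proof.
move=> st; split.
  apply: (measurableT_comp (@measurable_expR R)).
  apply: measurable_funD; last exact: measurable_cst.
  apply: measurable_funM; first exact: measurable_cst.
  exact: measurable_sin2_past.
exists (expR (`|a| + b)) => w; rewrite ger0_norm ?expR_ge0// ler_expR lerD2r.
have := S_le1 s w; have := S_ge0 s w; have := ler_norm a; have := normr_ge0 a; nra.
Qed.

Lemma bounded_W_past s t : (s <= t)%N -> bounded_past t (W s).
Proof.
move=> st; have := @bounded_exp_past s t (theta * n s) 0 st.
by rewrite /W; under eq_fun do rewrite addr0.
Qed.

(** [phi] stands for a past event inside [S t <= 1/2]. The bound of [expW_step] is affine in the
    drift, so the drift may be replaced by its conditional mean before [mean_drift_ge] and
    [expR_contraction] are applied pointwise. *)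
Lemma expect_W_step t phi : bounded_past t phi ->
  (forall w, 0 <= phi w) -> (forall w, phi w != 0 -> S t w <= 1 / 2) ->
  \int[P]_w (phi w * W t.+1 w) <= \int[P]_w (phi w * (W t w + 1 / n t.+1)).
Proof.
move=> bphi phi0 phiS.
pose E w := expR (n t.+1 * theta * S t w + 1 / (8 * n t.+1)).
pose Phi w := phi w * E w.
have bPhi : bounded_past t Phi by apply: bounded_rvM => //; exact: bounded_exp_past.
have bS : bounded_past t (S t).
  split; first exact: measurable_sin2_past.
  by exists 1 => w; rewrite ger0_norm.
have bS2 : bounded_past t (fun w => 1 + theta / 2 * S t w).
  by apply: bounded_rvD; [exact: bounded_rv_cst|];
    apply: bounded_rvM => //; exact: bounded_rv_cst.
have bdrift : bounded_rv (fun w => drift v1 (V t w) (X t.+1 w)).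
  under eq_fun do rewrite driftE.
  apply: bounded_rv_sum => i; apply: bounded_rv_sum => j.
  apply: bounded_rvM; first exact: bounded_cov.
  exact: bounded_past_rv (bounded_drift_coef t i j).
have bmean : bounded_past t (fun w => \sum_i \sum_j Sigma i j * drift_coef v1 (V t w) i j).
  apply: bounded_rv_sum => i; apply: bounded_rv_sum => j.
  by apply: bounded_rvM; [exact: bounded_rv_cst | exact: bounded_drift_coef].
have bPD : bounded_rv (fun w => Phi w * drift v1 (V t w) (X t.+1 w)).
  by apply: bounded_rvM => //; exact: bounded_past_rv bPhi.
have bPM : bounded_rv (fun w => Phi w * \sum_i \sum_j Sigma i j * drift_coef v1 (V t w) i j).
  by apply: (@bounded_past_rv t); exact: bounded_rvM.
have bPS : bounded_rv (fun w => Phi w * (1 + theta / 2 * S t w)).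
  by apply: (@bounded_past_rv t); exact: bounded_rvM.
have bc c (f : T -> R) : bounded_rv f -> bounded_rv (fun w => c * f w).
  by move=> bf; apply: bounded_rvM => //; exact: bounded_rv_cst.
have bWt : bounded_rv (fun w => phi w * (W t w + 1 / n t.+1)).
  apply: bounded_rvM; first exact: bounded_past_rv bphi.
  apply: bounded_rvD; last exact: bounded_rv_cst.
  exact: bounded_past_rv (bounded_W_past (leqnn t)).
have bWt1 : bounded_rv (fun w => phi w * W t.+1 w).
  apply: bounded_rvM; first exact: bounded_past_rv bphi.
  exact: bounded_past_rv (bounded_W_past (leqnn t.+1)).
pose c := - (4 * theta / rho).
apply: (@le_trans _ _ (\int[P]_w (Phi w * (1 + theta / 2 * S t w) +
    c * (Phi w * drift v1 (V t w) (X t.+1 w))))).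
  apply: le_expect => //; first by apply: bounded_rvD => //; exact: bc.
  move=> w; apply: le_trans (ler_wpM2l (phi0 w) (expW_step t w)) _.
  by rewrite /Phi /E /c (mulrA (n t.+1)) le_eqVlt; apply/orP; left; apply/eqP; field; rewrite gt_eqF.
rewrite expectD//; last exact: bc.
rewrite expectZ// expect_drift// -expectZ// -expectD//; last exact: bc.
apply: le_expect => //; first by apply: bounded_rvD => //; exact: bc.
move=> w; have [e0|ne0] := eqVneq (phi w) 0.
  by rewrite /Phi e0 !mul0r mulr0 addr0.
have S12 := phiS w ne0; have S0 := S_ge0 t w.
rewrite /Phi -!mulrA (mulrCA c) -mulrDr ler_wpM2l//.
rewrite (mulrCA c) -mulrDr.
have m1 : 1 < n t.+1 by have := n_ge1 t; rewrite /n -natr1; lra.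
have s0 : 0 <= theta * S t w by rewrite mulr_ge0// ltW.
have := expR_contraction s0 m1.
have -> : (n t.+1 - 1) * (theta * S t w) = theta * n t * S t w.
  by rewrite /n -natr1; ring.
apply: le_trans; rewrite /E -mulrA ler_wpM2l ?expR_ge0//.
have := mean_drift_ge v11 (Vgt0 t w) Sv1 (gapSigma (V t w)).
rewrite -/(S t w) -/rho => h.
have c0 : c <= 0 by rewrite /c oppr_le0 divr_ge0 ?ltW// mulr_gt0.
have := ler_wnM2l c0 h.
have -> : c * (rho * S t w * (1 - S t w)) = - (4 * theta * S t w * (1 - S t w)).
  by rewrite /c; field; rewrite gt_eqF.
(* Here [S t <= 1/2] enters: with [s = theta * S t], the mean drift removes at least the [2 * s] of
   [expR_contraction]. *)
have : theta * S t w <= 2 * (theta * S t w) * (1 - S t w) by nra.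
lra.
Qed.

Let a t : R := 1 + ln (n t / L).

Lemma weight_ge1 t : 1 <= a t.
Proof.
rewrite lerDl ln_ge0// ler_pdivlMr//;
  by rewrite mul1r /n lerDr ler0n.
Qed.

Lemma weight_step t : a t + (n t.+1)^-1 <= a t.+1.
Proof.
have n1 := n_ge1 t; have L0' := L0.
have -> : a t.+1 = a t + ln (n t.+1 / (n t.+1 - 1)).
  rewrite /a -addrA -lnM ?posrE; try by apply: divr_gt0; rewrite /n -?natr1; rewrite /n in n1; lra.
  congr (_ + ln _); rewrite /n -natr1; rewrite /n in n1; field.
  by rewrite !gt_eqF//; lra.
rewrite lerD2l; apply: ln_incr_ge; rewrite /n -natr1; rewrite /n in n1; lra.
Qed.

Let G t w := W t w / a t ^+ 2 + (a t)^-1.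
Let E0 w := S 0%N w <= 1 / 4.

Lemma measurable_E0_past t :
  measurable_fun (setT : set (g_sigma_algebraType (hist t))) E0.
Proof.
apply: measurable_fun_ler; last exact: measurable_cst.
exact: measurable_sin2_past.
Qed.

Lemma bounded_G_past s t : (s <= t)%N -> bounded_past t (G s).
Proof.
move=> st; apply: bounded_rvD; last exact: bounded_rv_cst.
by apply: bounded_rvM; [exact: bounded_W_past | exact: bounded_rv_cst].
Qed.

Lemma bounded_alive_past t : bounded_past t (fun w => (alive E0 G K t.+1 w)%:R).
Proof.
apply: bounded_rv_bool.
(* [alive t.+1] involves [G s] for [s <= t] only; the bound on [s] keeps the induction inside the
   past at time [t]. *)
suff : forall s, (s <= t.+1)%N ->
    measurable_fun (setT : set (g_sigma_algebraType (hist t))) (alive E0 G K s).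
  exact.
elim=> [_|s IH st]; first exact: measurable_E0_past.
apply: measurable_and; first by apply: IH; exact: ltnW.
apply: measurable_fun_ltr; last exact: measurable_cst.
by case: (bounded_G_past (st : (s <= t)%N)).
Qed.

Let W_ge0 t w : 0 <= W t w. Proof. exact: expR_ge0. Qed.

Lemma G_ge0 t w : 0 <= G t w.
Proof.
have := weight_ge1 t => a1; rewrite addr_ge0// ?divr_ge0 ?invr_ge0 ?sqr_ge0//; lra.
Qed.

(* Below the threshold the iterate stays in the region [sin2 <= 1/2], where the
   drift contracts. *)
Hypothesis K_half : forall t, K * a t ^+ 2 <= expR (theta * n t / 2).

Lemma alive_W t w : alive E0 G K t.+1 w -> W t w < K * a t ^+ 2.
Proof.
move=> /= /andP[_ h]; have a1 := weight_ge1 t.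
rewrite -ltr_pdivrMr ?exprn_gt0//; last lra.
by apply: le_lt_trans h; rewrite /G lerDl invr_ge0; lra.
Qed.

(** Survival and [K_half] give [theta * n * S < theta * n / 2]. *)
Lemma alive_half t w : alive E0 G K t.+1 w -> S t w <= 1 / 2.
Proof.
move=> /alive_W /(lt_le_trans)/(_ (K_half t)); rewrite ltr_expR.
have n1 := n_ge1 t; have : 0 < theta * n t by rewrite mulr_gt0//; lra.
move=> h0 h; nra.
Qed.

(** [expect_W_step] with the survival indicator as [phi], then [weight_telescope] pointwise. *)
Lemma G_supermartingale t :
  \int[P]_w ((alive E0 G K t.+1 w)%:R * G t.+1 w) <=
  \int[P]_w ((alive E0 G K t.+1 w)%:R * G t w).
Proof.
set phi := fun w => (alive E0 G K t.+1 w)%:R : R.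
have bphi : bounded_past t phi := bounded_alive_past t.
have bphi' := bounded_past_rv bphi.
have bW s : bounded_rv (fun w => phi w * W s w).
  by apply: bounded_rvM => //; exact: bounded_past_rv (bounded_W_past (leqnn s)).
have bc c (f : T -> R) : bounded_rv f -> bounded_rv (fun w => c * f w).
  by move=> bf; apply: bounded_rvM => //; exact: bounded_rv_cst.
have bW1 : bounded_rv (fun w => phi w * (W t w + 1 / n t.+1)).
  apply: bounded_rvM => //; apply: bounded_rvD; last exact: bounded_rv_cst.
  exact: bounded_past_rv (bounded_W_past (leqnn t)).
have phi0 w : 0 <= phi w by rewrite /phi ler0n.
have step : \int[P]_w (phi w * W t.+1 w) <= \int[P]_w (phi w * (W t w + 1 / n t.+1)).
  apply: expect_W_step => // w; rewrite /phi.
  by case: (boolP (alive E0 G K t.+1 w)) => [/alive_half//|]; rewrite eqxx.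
have -> : \int[P]_w (phi w * G t.+1 w) =
    \int[P]_w ((a t.+1 ^+ 2)^-1 * (phi w * W t.+1 w) + (a t.+1)^-1 * phi w).
  by apply: eq_Rintegral => w _; rewrite /G; ring.
rewrite expectD//; try exact: bc.
rewrite expectZ//.
apply: (@le_trans _ _ ((a t.+1 ^+ 2)^-1 * \int[P]_w (phi w * (W t w + 1 / n t.+1))
    + \int[P]_w ((a t.+1)^-1 * phi w))).
  by rewrite lerD2r ler_wpM2l// invr_ge0 sqr_ge0.
rewrite -expectZ// -expectD//; try exact: bc.
apply: le_expect; first by apply: bounded_rvD; exact: bc.
  by apply: bounded_rvM => //; exact: bounded_past_rv (bounded_G_past (leqnn t)).
move=> w; rewrite mulrCA [X in _ + X]mulrC -mulrDr ler_wpM2l//.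
rewrite mulrC; apply: weight_telescope => //; [exact: weight_ge1|exact: weight_step|].
exact: lt_le_trans ltr01 (n_ge1 _).
Qed.

(** On [E0], [G 0 = W 0 + 1] is at most [2 * exp (theta * L / 4)], so Ville's bound loses at most
    [delta]. Survival is then turned into a bound on [S] by taking logarithms. *)
Theorem sin2_uniform_bound (delta : R) : 0 < delta -> 0 < K ->
  2 * expR (theta * L / 4) <= delta * K ->
  ((fine (P [set w | (sin2 (v0 w) v1 <= 1 / 4)%R]) - delta)%:E <=
   P [set w | forall t, (S t w <= ln (K * a t ^+ 2) / (theta * n t))%R])%E.
Proof.
move=> delta0 K0 hK.
set A := [set w | forall t, alive E0 G K t w].
have mE0 : measurable_fun setT E0 by exact: (@measurable_past 0%N _ bool _ (@measurable_E0_past 0%N)).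
have bG t : bounded_rv (G t) by exact: bounded_past_rv (bounded_G_past (leqnn t)).
have G0 w : E0 w -> G 0%N w <= 2 * expR (theta * L / 4).
  move=> h; have a0 : a 0%N = 1.
    by rewrite /a /n add0r divff ?ln1 ?addr0// gt_eqF.
  rewrite /G a0 expr1n invr1 mulr1.
  have : W 0%N w <= expR (theta * L / 4).
    rewrite /W /n add0r ler_expR; rewrite /E0 in h.
    have : 0 < theta * L by rewrite mulr_gt0.
    nra.
  have : 1 <= expR (theta * L / 4).
    apply: le_trans (expR_ge1Dx _); by rewrite lerDl divr_ge0// mulr_ge0// ltW.
  lra.
have VB := @Ville_bound _ _ _ P E0 G K _ K0 mE0 bG G0
   (mulr_ge0 (ler0n R 2) (expR_ge0 _)) G_supermartingale G_ge0.
have mA : measurable A.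
  rewrite (_ : A = \bigcap_t [set w | alive E0 G K t w]).
    apply: bigcapT_measurable => t; apply: measurable_bool_set.
    exact: measurable_alive.
  by apply/seteqP; split => [w h t _|w h t]; [exact: h | exact: (h t I)].
apply: (@le_trans _ _ (P A)).
  apply: le_trans VB; rewrite lee_fin lerD2l lerN2.
  by rewrite ler_pdivrMr.
apply: le_measure; rewrite ?inE//.
  rewrite (_ : [set w | _] = \bigcap_t [set w | S t w <= ln (K * a t ^+ 2) / (theta * n t)]).
    apply: bigcapT_measurable => t; apply: measurable_bool_set.
    apply: measurable_fun_ler; last exact: measurable_cst.
    exact: (@measurable_past t _ R _ (measurable_sin2_past (leqnn t))).
  by apply/seteqP; split => [w h t _|w h t]; [exact: h | exact: (h t I)].
(* The constraint on [G t] is carried by [alive t.+1], not by [alive t]. *)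
move=> w Aw t /=; have := alive_W (Aw t.+1).
have n1 := n_ge1 t; have a1 := weight_ge1 t.
have Ka : 0 < K * a t ^+ 2 by rewrite mulr_gt0// exprn_gt0//; lra.
rewrite -[X in _ < X -> _](lnK (_ : _ \in Num.pos))// ltr_expR => h.
rewrite ler_pdivlMr; first by rewrite mulrC ltW.
by rewrite mulr_gt0//; lra.
Qed.

End Supermartingale.

(** * Expectation of a product of independent variables *)

Section IndependentExpectation.
Context {d : measure_display} {T : measurableType d} {R : realType}.
Variables (P : probability T R) (f g : T -> R).
Hypotheses (bf : bounded_rv f) (bg : bounded_rv g).
Hypothesis indep : forall A B : set R, measurable A -> measurable B ->
  P (f @^-1` A `&` g @^-1` B) = (P (f @^-1` A) * P (g @^-1` B))%E.

(** Independence on rectangles makes the joint law the product of the marginal laws; Fubini then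
    separates the integrals. *)
Lemma expect_indep_mul : \int[P]_w (f w * g w) = \int[P]_w f w * \int[P]_w g w.
Proof.
have [mf _] := bf; have [mg _] := bg.
have mfg : measurable_fun setT (fun w => (f w, g w)) by exact: measurable_fun_pair.
pose F : {mfun T >-> R} := mfun_Sub (mem_set mf).
pose G : {mfun T >-> R} := mfun_Sub (mem_set mg).
pose FG : {mfun T >-> (R * R)%type} := mfun_Sub (mem_set mfg).
pose h (z : R * R) := (z.1 * z.2)%:E.
have mh : measurable_fun setT h.
  by apply/measurable_EFinP; apply: measurable_funM.
have prodE (A : set (R * R)) : measurable A ->
    (distribution P F \x distribution P G)%E A = distribution P FG A.
  by move=> mA; apply: product_measure_unique => // A1 A2 mA1 mA2; exact: indep.
have intE (k : R * R -> \bar R) :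
    (\int[(distribution P F \x distribution P G)%E]_z k z)%E =
    (\int[distribution P FG]_z k z)%E.
  by apply: eq_measure_integral => A mA _; exact: prodE.
have ifg : P.-integrable setT (EFin \o (fun w => f w * g w)).
  exact/bounded_rv_integrable/bounded_rvM.
have ih : (distribution P F \x distribution P G)%E.-integrable setT h.
  apply/integrableP; split => //.
  rewrite intE ge0_integral_distribution//; last exact: measurableT_comp.
  by move/integrableP : ifg => [].
have ig : P.-integrable setT (EFin \o g) by exact: bounded_rv_integrable.
have if_ : P.-integrable setT (EFin \o f) by exact: bounded_rv_integrable.
have iG : (\int[distribution P G]_y y%:E = \int[P]_w (g w)%:E)%E.
  by rewrite integral_distribution.
have igG : (distribution P G).-integrable setT (EFin : R -> \bar R).
  by apply: (@integrable_pushforward _ _ _ _ _ G _ P setT).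
have gfin : (\int[P]_w (g w)%:E)%E \is a fin_num by exact: integrable_fin_num.
have := integral12_prod_meas1 ih.
rewrite intE integral_distribution// => h12.
rewrite /Rintegral -[in LHS]h12 /fubini_F /h/=.
under eq_integral do under eq_integral do rewrite EFinM.
under eq_integral do rewrite integralZl// iG -(fineK gfin).
rewrite integral_distribution//; last 2 first.
- apply: emeasurable_funM; first exact/measurable_EFinP.
  exact: measurable_cst.
- exact: (integrableZr measurableT _ if_).
by rewrite -[LHS]/(Rintegral P setT (fun w => f w * _)) RintegralZr.
Qed.

End IndependentExpectation.

(** * Independence of a new sample from the past *)

Section Independence.
Context {d : measure_display} {T : measurableType d} {R : realType} {p : nat}.
Variables (P : probability T R) (Y : nat -> T -> 'cV[R]_p).
Hypothesis mY : forall k, random_vec (Y k).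
Hypothesis indepY : mutually_independent P Y.

Lemma sigma_algebra_sigma_of (Z : T -> 'cV[R]_p) : sigma_algebra setT (sigma_of Z).
Proof.
have -> : sigma_of Z = preimage_set_system setT Z (@borel_vec R p).
  by apply/seteqP; split => [A [C [mC ->]]|A [C mC <-]]; exists C; rewrite ?setTI.
exact/sigma_algebra_preimage/smallest_sigma_algebra.
Qed.

Lemma sigma_ofT (Z : T -> 'cV[R]_p) : sigma_of Z setT.
Proof.
by have [h0 hC _] := sigma_algebra_sigma_of Z; have := hC _ h0; rewrite setD0.
Qed.

Lemma sigma_ofI (Z : T -> 'cV[R]_p) A B : sigma_of Z A -> sigma_of Z B ->
  sigma_of Z (A `&` B).
Proof.
by have /sigma_algebraP[|_ _ _] // := sigma_algebra_sigma_of Z; exact.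
Qed.

Lemma random_vec_sigma_of (Z : T -> 'cV[R]_p) :
  random_vec (Z : g_sigma_algebraType (sigma_of Z) -> 'cV[R]_p).
Proof.
move=> i _ A mA; rewrite setTI; apply: sub_sigma_algebra.
exists [set v | A (v i 0)]; split => //.
by apply: sub_sigma_algebra; exists i, A.
Qed.

Lemma sigma_of_measurable k : sigma_of (Y k) `<=` measurable.
Proof.
move=> A [C [mC ->]].
apply: (smallest_sub (X := [set C | measurable (Y k @^-1` C)])) mC => /=.
  split => /= [|D mD|F mF]; first by rewrite preimage_set0.
    by rewrite setTD preimage_setC; exact: measurableC.
  by rewrite preimage_bigcup; exact: bigcup_measurable.
move=> _ [i [D [mD ->]]] /=.
by rewrite -[X in measurable X]setTI; exact: mY.
Qed.

(* A pi-system generating the past of [Y] up to time [t]. *)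
Definition history t : set (set T) := [set A | exists F : nat -> set T,
  (forall k, sigma_of (Y k) (F k)) /\ A = \bigcap_(k in [set k | (k <= t)%N]) F k].

Lemma sub_history t k A : (k <= t)%N -> sigma_of (Y k) A -> history t A.
Proof.
move=> kt sA; exists (fun j => if j == k then A else setT); split.
  by move=> j; case: eqP => [->//|_]; exact: sigma_ofT.
apply/seteqP; split => [w Aw j /= _|w /(_ k kt)]; last by rewrite /= eqxx.
by case: eqP.
Qed.

Lemma history_measurable t : history t `<=` measurable.
Proof.
move=> A [F [sF ->]]; apply: bigcap_measurable; first by exists 0%N.
by move=> k _; exact: sigma_of_measurable (sF k).
Qed.

Lemma history_setI t : setI_closed (history t).
Proof.
move=> _ _ [F [sF ->]] [G [sG ->]]; exists (fun k => F k `&` G k).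
split => [k|]; first exact: sigma_ofI.
by rewrite bigcapI.
Qed.

Lemma random_vec_history k t : (k <= t)%N ->
  random_vec (Y k : g_sigma_algebraType (history t) -> 'cV[R]_p).
Proof.
move=> kt i _ A mA; rewrite setTI; apply: sub_sigma_algebra.
apply: (sub_history kt); exists [set v | A (v i 0)]; split => //.
by apply: sub_sigma_algebra; exists i, A.
Qed.

Lemma history_indep_basic t A C : history t A -> sigma_of (Y t.+1) C ->
  P (A `&` C) = (P A * P C)%E.
Proof.
move=> [F [sF ->]] sC.
(* [C] fills slot [t.+1], so the whole intersection is one instance of mutual independence; a second
   instance, over the indices up to [t], recovers the factor of the past. *)
pose F' k := if k == t.+1 then C else F k.
have sF' k : sigma_of (Y k) (F' k) by rewrite /F'; case: eqP => [->|].
have cap (G : nat -> set T) m : \bigcap_(k in [set k | k \in iota 0 m]) G k =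
    \bigcap_(k in [set k | (k < m)%N]) G k.
  by apply: eq_bigcapl; split => k /=; rewrite mem_iota.
have EC : \bigcap_(k in [set k | (k <= t)%N]) F k `&` C =
    \bigcap_(k in [set k | k \in iota 0 t.+2]) F' k.
  rewrite cap; apply/seteqP; split => [w [h Cw] k /=|w h].
    rewrite /F' ltnS; case: eqP => [//|/eqP kt] le; apply: h.
    by rewrite /= -ltnS ltn_neqAle kt.
  split => [k /= kt|].
    have := h k; rewrite /= /F' ltnS (leq_trans kt)// => /(_ isT).
    by rewrite ltn_eqF.
  by have := h t.+1; rewrite /= /F' eqxx ltnSn; exact.
have E1 : \bigcap_(k in [set k | (k <= t)%N]) F k =
    \bigcap_(k in [set k | k \in iota 0 t.+1]) F k by rewrite cap.
rewrite EC indepY ?iota_uniq//.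
rewrite -[in RHS]/(F' t.+1) E1 indepY ?iota_uniq//.
rewrite -addn1 iotaD big_cat/= big_seq1 add0n /F' eqxx; congr (_ * _)%E.
rewrite big_seq [RHS]big_seq; apply: eq_bigr => k.
rewrite -[_ :: _]/(iota 0 t.+1) mem_iota add0n => /andP[_ kt].
by rewrite ltn_eqF.
Qed.

(** For fixed [C], the restriction of [P] to [C] and [P] scaled by [P C] are finite measures that
    agree on the pi-system [history t], hence on the sigma-algebra it generates. *)
Lemma history_indep t A C : <<s history t >> A -> sigma_of (Y t.+1) C ->
  P (A `&` C) = (P A * P C)%E.
Proof.
move=> sA sC; have mC := sigma_of_measurable sC.
have PC0 : 0 <= fine (P C) by apply: fine_ge0.
have PCE : P C = (fine (P C))%:E by rewrite fineK// fin_num_measure.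
have E D : mscale (NngNum PC0) P D = (P D * P C)%E.
  by rewrite /mscale/= [in RHS]PCE muleC.
rewrite -E -[LHS]/(mrestr P mC A).
apply: (@g_sigma_algebra_measure_unique _ R T (history t) _ (fun=> setT)) sA.
- exact: history_measurable.
- by move=> _; apply: (@sub_history t 0%N) => //; exact: sigma_ofT.
- by rewrite bigcup_const//; exists 0%N.
- exact: history_setI.
- by move=> D hD; rewrite /= E; exact: history_indep_basic hD sC.
- by move=> _; rewrite /= /mrestr setTI PCE ltry.
Qed.

Lemma expect_history_mul t (phi psi : T -> R) (M : R) :
  measurable_fun (setT : set (g_sigma_algebraType (history t))) phi ->
  (forall w, `|phi w| <= M) -> bounded_rv psi ->
  measurable_fun (setT : set (g_sigma_algebraType (sigma_of (Y t.+1)))) psi ->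
  \int[P]_w (phi w * psi w) = \int[P]_w phi w * \int[P]_w psi w.
Proof.
move=> mphi phiM bpsi spsi; apply: expect_indep_mul => //.
  split; last by exists M.
  move=> _ A mA; have /= h := mphi measurableT A mA.
  apply: (smallest_sub _ _ h); last exact: history_measurable.
  by split => [|D mD|F mF];
    [exact: measurable0 | rewrite setTD; exact: measurableC | exact: bigcup_measurable].
move=> A B mA mB; apply: (@history_indep t); last first.
  have /= := spsi measurableT B mB; rewrite setTI; apply: smallest_sub => //.
  exact: sigma_algebra_sigma_of.
by have := mphi measurableT A mA; rewrite setTI.
Qed.

End Independence.

(** * Numerical constants and the survival threshold *)

Section Constants.
Context {R : realType}.

(** Ensures [ln (t + 9) >= 1], so that the iterated logarithm is nonnegative. *)
Lemma expR1_le9 : expR 1 <= 9 :> R.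
Proof.
have -> : expR 1 = expR (1 / 4) ^+ 4 :> R.
  by rewrite -expRM_natl; congr expR; field.
have h : expR (1 / 4) <= 3 / 2 :> R.
  by apply: le_trans (expR_le_quad (lexx _)) _; lra.
apply: (@le_trans _ _ ((3 / 2) ^+ 4)); first by rewrite lerXn2r// nnegrE ?expR_ge0//; lra.
by rewrite !exprS expr0; lra.
Qed.

Lemma ln_ge1 (x : R) : expR 1 <= x -> 1 <= ln x.
Proof.
move=> h; have x0 : 0 < x by apply: lt_le_trans h; exact: expR_gt0.
by rewrite -[leLHS]expRK ler_ln// posrE expR_gt0.
Qed.

Lemma ln_ratio_le (n L : R) : 0 < L -> 0 < n -> 1 + ln (n / L) <= n / L.
Proof.
move=> L0 n0; have r0 : 0 < n / L by rewrite divr_gt0.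
have := @le_ln1Dx R (n / L - 1); rewrite subrKC => h.
by rewrite -lerBrDl; apply: h; lra.
Qed.

Section Thresholds.
Variables (l theta L delta : R) (t : nat).
Hypotheses (delta0 : 0 < delta) (lE : l = ln delta^-1) (l1 : 1 <= l).
Hypotheses (theta0 : 0 < theta) (L1 : 1 <= L) (thL : 16 * l ^+ 2 <= theta * L).
Let K := 2 * expR (theta * L / 4) / delta.
Let a := 1 + ln ((t%:R + L) / L).

(** [exp 1] absorbs the factor 2, and [1 / delta = exp l]. *)
Let K_le : K <= expR (1 + theta * L / 4 + l).
Proof.
have dE : delta^-1 = expR l by rewrite lE lnK// posrE invr_gt0.
rewrite /K dE !expRD ler_wpM2r ?expR_ge0// ler_wpM2r ?expR_ge0//.
by apply: le_trans (expR_ge1Dx _); lra.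
Qed.

Let log_factor_ge1 : 1 <= a.
Proof.
have t0 := ler0n R t; have L1' := L1.
rewrite lerDl ln_ge0// ler_pdivlMr ?mul1r; lra.
Qed.

(** Supplies [K_half]. As [a <= 1 + t / L <= exp (t / L)], it suffices that [1 + theta L / 4 + l + 2
    t / L <= theta (t + L) / 2], which follows from [theta L >= 16 l^2] and [l >= 1]. *)
Lemma threshold_half : K * a ^+ 2 <= expR (theta * (t%:R + L) / 2).
Proof.
have [t0 L1' l1' thL' th0] := And5 (ler0n R t) L1 l1 thL theta0.
have a_le : a <= expR (t%:R / L).
  apply: (@le_trans _ _ ((t%:R + L) / L)); first by apply: ln_ratio_le; lra.
  rewrite mulrDl divff ?gt_eqF//; last lra.
  by rewrite addrC; exact: expR_ge1Dx.
have a2 : a ^+ 2 <= expR (2 * (t%:R / L)).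
  rewrite mulr2n mulrDl mul1r expRD -expr2 lerXn2r// nnegrE ?expR_ge0//.
  by have := log_factor_ge1; lra.
apply: (@le_trans _ _ (expR (1 + theta * L / 4 + l) * expR (2 * (t%:R / L)))).
  by apply: ler_pM => //; rewrite ?sqr_ge0// /K divr_ge0 ?mulr_ge0 ?expR_ge0 ?ltW.
rewrite -expRD ler_expR.
have l2 : l <= l ^+ 2 by rewrite expr2 ler_peMl//; lra.
have : 2 * (t%:R / L) <= theta * t%:R / 2.
  rewrite mulrA ler_pdivrMr; last lra.
  have : 16 * t%:R <= theta * L * t%:R by rewrite ler_wpM2r//; lra.
  have -> : theta * t%:R / 2 * L = theta * L * t%:R / 2 by ring.
  lra.
lra.
Qed.

(** From [ln a <= 1 + ln ln (t + 9)], the numerator is at most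
    [theta L / 4 + l + 3 + 2 ln ln (t + 9)]; each term is absorbed because [theta L / l >= 16]. *)
Lemma threshold_final :
  ln (K * a ^+ 2) / (theta * (t%:R + L)) <=
    252 * L / l * ((l + 2 * ln (ln (t%:R + 9))) / (t%:R + L)).
Proof.
have [t0 L1' l1' thL' th0] := And5 (ler0n R t) L1 l1 thL theta0.
have a1 := log_factor_ge1.
have K0 : 0 < K by rewrite /K divr_gt0 ?mulr_gt0 ?expR_gt0.
have lt1 : 1 <= ln (t%:R + 9) :> R.
  by apply: ln_ge1; have := expR1_le9; lra.
have lam0 : 0 <= ln (ln (t%:R + 9)) :> R by exact: ln_ge0.
have lna : ln a <= 1 + ln (ln (t%:R + 9)).
  apply: (@le_trans _ _ (ln (expR 1 * ln (t%:R + 9)))); last first.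
    by rewrite lnM ?posrE ?expR_gt0 ?expRK//; lra.
  rewrite ler_ln ?posrE ?mulr_gt0 ?expR_gt0//; try lra.
  have : ln ((t%:R + L) / L) <= ln (t%:R + 9).
    rewrite ler_ln ?posrE ?divr_gt0//; try lra.
    rewrite ler_pdivrMr; nra.
  have := expR_ge1Dx (1 : R); rewrite /a; nra.
have lnKa : ln (K * a ^+ 2) <= theta * L / 4 + l + 3 + 2 * ln (ln (t%:R + 9)).
  rewrite lnM ?posrE ?exprn_gt0//; last lra.
  rewrite lnXn; last lra.
  have : ln K <= 1 + theta * L / 4 + l.
    by rewrite -[leRHS]expRK ler_ln// posrE expR_gt0.
  rewrite mulr2n; lra.
rewrite invfM [leLHS]mulrA [leRHS]mulrA; apply: ler_wpM2r; first by rewrite invr_ge0; lra.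
rewrite ler_pdivrMr//; apply: le_trans lnKa _.
set m := ln (ln _) in lam0 lna *.
have -> : 252 * L / l * (l + 2 * m) * theta =
    252 * (theta * L) + 504 * (theta * L / l * m).
  by field; rewrite gt_eqF//; lra.
have : 16 <= theta * L / l by rewrite ler_pdivlMr; nra.
nra.
Qed.

End Thresholds.
End Constants.

(** * Truncation of the samples *)

Section Truncation.
Context {d : measure_display} {T : measurableType d} {R : realType} {p : nat}.
Variables (B : R).

(** Turns the almost sure bound into one valid at every point; as a fixed measurable function of the
    sample, it preserves independence from the past. *)
Definition truncv (u : 'cV[R]_p) : 'cV[R]_p :=
  if dotv u u <= B ^+ 2 then u else 0.

Lemma dotv_truncv u : dotv (truncv u) (truncv u) <= B ^+ 2.
Proof.
rewrite /truncv; case: ifP => // _.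
by rewrite /dotv big1 ?sqr_ge0// => i _; rewrite mxE mul0r.
Qed.

Lemma random_vec_truncv (Z : T -> 'cV[R]_p) : random_vec Z ->
  random_vec (fun w => truncv (Z w)).
Proof.
move=> mZ i.
have -> : (fun w => truncv (Z w) i 0) =
    (fun w => if dotv (Z w) (Z w) <= B ^+ 2 then Z w i 0 else 0).
  by apply/funext => w; rewrite /truncv; case: ifP => // _; rewrite mxE.
apply: measurable_fun_ifT; [|exact: mZ|exact: measurable_cst].
apply: measurable_fun_ler; first exact: measurable_dotv.
exact: measurable_cst.
Qed.

End Truncation.

(** * Transfer to the original samples and assembly *)

Lemma KOiter_eq (R : realType) (p : nat) (T : Type) (v0 : T -> 'cV[R]_p)
    (X X' : nat -> T -> 'cV[R]_p) eta t w :
  (forall k, X k.+1 w = X' k.+1 w) -> KOiter v0 X eta t w = KOiter v0 X' eta t w.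
Proof. by move=> XX'; elim: t => [//|t IH] /=; rewrite IH XX'. Qed.
Unset Implicit Arguments.
Theorem theorem3 (R : realType) (d : measure_display) (T : measurableType d)
  (P : probability T R) (p : nat) (X : nat -> T -> 'cV[R]_p)
  (v0 : T -> 'cV[R]_p) (Sigma : 'M[R]_p) (B : R)
  (lam : nat -> R) (U : 'M[R]_p) (v1 : 'cV[R]_p) (delta : R) :
  (2 <= p)%N ->
  (* the X_t (t >= 1) are random vectors, i.i.d., centered, covariance Sigma,
     a.s. bounded by B; v0 is a random unit vector independent of (X_t) *)
  (forall t, (1 <= t)%N -> random_vec (X t)) ->
  random_vec v0 ->
  mutually_independent P (fun t => if t == 0%N then v0 else X t) ->
  (forall t, (1 <= t)%N -> same_law P (X t) (X 1%N)) ->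
  (forall t, (1 <= t)%N -> forall i : 'I_p,
      (\int[P]_w (X t w i 0)%:E)%E = 0%E) ->
  (forall t, (1 <= t)%N -> forall i j : 'I_p,
      (\int[P]_w (X t w i 0 * X t w j 0)%:E)%E = (Sigma i j)%:E) ->
  (forall t, (1 <= t)%N -> {ae P, forall w, normv (X t w) <= B}) ->
  (forall w, normv (v0 w) = 1) ->
  (* eigenvalues lam 0 >= lam 1 >= ... >= lam (p-1) of Sigma, with
     orthonormal eigenbasis given by the columns of U *)
  U^T *m U = 1%:M ->
  Sigma = U *m diag_mx (\row_(i < p) lam i) *m U^T ->
  (forall i j : nat, (i <= j < p)%N -> lam j <= lam i) ->
  lam 0%N > lam 1%N ->
  (* v1 is a unit eigenvector for lam 0 *)
  normv v1 = 1 ->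
  Sigma *m v1 = lam 0%N *: v1 ->
  0 < delta < 1 ->
  (P [set w | (sin2 (v0 w) v1 <= 1 / 4)%R] >= (1 - delta ^+ 3)%:E)%E ->
  let rho := lam 0%N - lam 1%N in
  let L : R := Num.max ((Num.ceil (128 * B ^+ 4 * (ln delta^-1) ^+ 2
                                    / rho ^+ 2))%:~R) 32 in
  let eta := fun t : nat => 2 / (rho * (t%:R + L)) in
  (P [set w | forall t : nat, (sin2 (KOiter v0 X eta t w) v1 <=
       Num.max (252 * L / ln delta^-1) (1008 * B ^+ 4 / rho ^+ 2) *
       ((ln delta^-1 + 2 * ln (ln (t%:R + 9))) / (t%:R + L)))%R]
   >= (1 - 2 * (expR 1 + 1) * delta)%:E)%E.

Proof.
move=> p2 mX mv0 indep _ _ covX XB v01 UU SigmaE lam_mono gap v11 Sv1 /andP[d0 d1]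
  PE0; cbv zeta.
set l := ln delta^-1; set rho := lam 0%N - lam 1%N.
set L := Num.max _ 32; set eta := fun t : nat => 2 / (rho * (t%:R + L)).
(* A nonpositive target probability is trivial; otherwise [delta] is below [1 / expR 1], hence
   [1 <= l]. *)
have [triv|small] := leP 1 (2 * (expR 1 + 1) * delta).
  by apply: le_trans (measure_ge0 P _); rewrite lee_fin; lra.
have e2 : 2 <= expR 1 :> R by apply: le_trans (expR_ge1Dx _); lra.
have l1 : 1 <= l.
  apply: ln_ge1; rewrite -[leRHS]div1r ler_pdivlMr//.
  nra.
have {}v11 := normv_eq1 v11; have {}v01 w := normv_eq1 (v01 w).
have rho0 : 0 < rho by rewrite subr_gt0.
pose Y t := if t == 0%N then v0 else X t.
have mY k : random_vec (Y k) by rewrite /Y; case: eqP => // /eqP k0; apply: mX; rewrite lt0n.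
pose X' t w := truncv B (X t w).
have X'B t w : dotv (X' t.+1 w) (X' t.+1 w) <= B ^+ 2 by exact: dotv_truncv.
have mX' t : random_vec (X' t.+1) by apply: random_vec_truncv; exact: mX.
have aeX : {ae P, forall w k, X' k.+1 w = X k.+1 w}.
  apply: ae_foralln => k; apply: filterS (XB k.+1 isT) => w /normv_le_dotv h.
  by rewrite /X' /truncv h.
have bcov t i j : bounded_rv (fun w => X' t.+1 w i 0 * X' t.+1 w j 0).
  exact: (@bounded_cov R d T p X' B X'B mX' t i j).
have meanX' t i j : \int[P]_w (X' t.+1 w i 0 * X' t.+1 w j 0) = Sigma i j.
  rewrite /Rintegral (_ : (\int[P]_w _)%E = (Sigma i j)%:E)//.
  rewrite -(covX t.+1 isT i j); apply: ae_eq_integral => //.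
  - by apply/measurable_EFinP; case: (bcov t i j).
  - by apply/measurable_EFinP; apply: measurable_funM; exact: mX.
  - by apply: filterS aeX => w h _; rewrite h.
have quadX' u : \int[P]_w (dotv (X' 1%N w) u ^+ 2) = dotv u (Sigma *m u).
  rewrite dotv_mulmx.
  transitivity (\int[P]_w (\sum_i \sum_j
      (u i 0 * u j 0) * (X' 1%N w i 0 * X' 1%N w j 0))).
    apply: eq_Rintegral => w _; rewrite expr2 /dotv mulr_suml.
    by apply: eq_bigr => i _; rewrite mulr_sumr; apply: eq_bigr => j _; ring.
  have bu i j : bounded_rv (fun w => (u i 0 * u j 0) * (X' 1%N w i 0 * X' 1%N w j 0)).
    by apply: bounded_rvM; [exact: bounded_rv_cst | exact: (bcov 0%N)].
  rewrite expect_sum; last by move=> i; exact: bounded_rv_sum.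
  apply: eq_bigr => i _; rewrite expect_sum//; apply: eq_bigr => j _.
  by rewrite expectZ ?(meanX' 0%N) 1?mulrC//; exact: (bcov 0%N).
(* Both eigenvalues are second moments of linear forms of a truncated sample, so [0 <= lam 1] and
   [lam 0 <= B ^+ 2]. This yields [1 <= beta]. *)
have rhoB : rho <= B ^+ 2.
  have lam1 : 0 <= lam 1%N.
    have [u <-] := second_eigval_form p2 UU SigmaE.
    by rewrite -quadX'; apply: Rintegral_ge0 => w _; exact: sqr_ge0.
  have lam0 : lam 0%N <= B ^+ 2.
    rewrite -(top_eigval_form v11 Sv1) -quadX' -(expect_cst P (B ^+ 2)).
    have sq w : dotv (X' 1%N w) v1 ^+ 2 <= B ^+ 2.
      apply: le_trans (dotv_CauchySchwarz _ _) _.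
      by rewrite v11 mulr1; exact: (X'B 0%N).
    apply: le_expect => //; last exact: bounded_rv_cst.
    split; last by exists (B ^+ 2) => w; rewrite ger0_norm ?sqr_ge0.
    apply: measurable_funX; apply: measurable_dotv; first exact: (mX' 0%N).
    exact: random_vec_cst.
  by rewrite /rho; lra.
set beta := B ^+ 2 / rho.
have beta1 : 1 <= beta by rewrite ler_pdivlMr// mul1r.
set theta := (8 * beta ^+ 2)^-1.
have beta0 : 0 < beta by exact: lt_le_trans ltr01 beta1.
have theta0 : 0 < theta by rewrite invr_gt0 mulr_gt0// exprn_gt0.
have L32 : 32 <= L by rewrite le_max lexx orbT.
have L1 : 1 <= L by lra.
have thL : 16 * l ^+ 2 <= theta * L.
  rewrite -ler_pdivrMl// invrK.
  (* Exactly the quantity under the ceiling in [L]. *)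
  have -> : 8 * beta ^+ 2 * (16 * l ^+ 2) = 128 * B ^+ 4 * l ^+ 2 / rho ^+ 2.
    by rewrite /beta; field; rewrite gt_eqF.
  by rewrite le_max ceil_ge.
(* Equality case of the requirement [2 * exp (theta * L / 4) <= delta * K]. *)
pose K := 2 * expR (theta * L / 4) / delta.
have K0 : 0 < K by rewrite divr_gt0// mulr_gt0// expR_gt0.
have core := @sin2_uniform_bound R d T P p X' v0 Sigma v1 B (lam 0%N) (lam 1%N) L K
  (history Y) v11 Sv1 (quad_form_gap p2 UU SigmaE lam_mono gap v11 Sv1) rho0 beta1 L1
  v01 X'B mX' (history_measurable mY).
(* [v0] is entry 0 of [Y], so it belongs to the past at every time. *)
have {}core := core (fun t => @random_vec_history _ _ _ _ Y 0%N t isT).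
have {}core : ((fine (P [set w | (sin2 (v0 w) v1 <= 1 / 4)%R]) - delta)%:E <=
   P [set w | forall t, (sin2 (KOiter v0 X' eta t w) v1 <=
    ln (K * (1 + ln ((t%:R + L) / L)) ^+ 2) / (theta * (t%:R + L)))%R])%E.
  apply: core => //.
  - move=> k t /andP[k1 kt]; apply: random_vec_truncv.
    have := @random_vec_history _ _ _ _ Y k t kt.
    by rewrite /Y; case: eqP k1 => [->|].
  - move=> t phi M i j mphi phiM.
    rewrite -(meanX' t i j) mulrC.
    apply: (expect_history_mul mY indep mphi phiM) => //.
    have mZ := random_vec_truncv B (@random_vec_sigma_of _ _ R p (X t.+1)).
    by apply: measurable_funM; exact: mZ.
  - by move=> t; exact: (threshold_half t d0 (erefl l) l1 theta0 L1 thL).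
  - by rewrite /K [leRHS]mulrC divfK ?lexx// gt_eqF.
set E0 := [set w | sin2 (v0 w) v1 <= 1 / 4] in core PE0.
set E := [set w | _]; set E' := [set w | _] in core.
have mE : measurable E.
  rewrite (_ : E = \bigcap_t [set w | sin2 (KOiter v0 X eta t w) v1 <=
       Num.max (252 * L / l) (1008 * B ^+ 4 / rho ^+ 2) *
       ((l + 2 * ln (ln (t%:R + 9))) / (t%:R + L))]).
    apply: bigcapT_measurable => t; apply: measurable_bool_set.
    apply: measurable_fun_ler; last exact: measurable_cst.
    apply: measurable_sin2; last exact: random_vec_cst.
    by apply: random_vec_KOiter => // k /andP[k1 _]; exact: mX.
  by apply/seteqP; split => [w h t _|w h t]; [exact: h | exact: (h t I)].
have mE' : measurable E'.
  rewrite (_ : E' = \bigcap_t [set w | sin2 (KOiter v0 X' eta t w) v1 <=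
    ln (K * (1 + ln ((t%:R + L) / L)) ^+ 2) / (theta * (t%:R + L))]).
    apply: bigcapT_measurable => t; apply: measurable_bool_set.
    apply: measurable_fun_ler; last exact: measurable_cst.
    apply: measurable_sin2; last exact: random_vec_cst.
    by apply: random_vec_KOiter => // -[|k]//.
  by apply/seteqP; split => [w h t _|w h t]; [exact: h | exact: (h t I)].
(* Off a null set truncation changes no sample, so both iterations coincide there and
   [threshold_final] leads from [E'] to [E]. *)
have E'E : (P E' <= P E)%E.
  have negl : P.-negligible (E' `\` E).
    apply: negligibleS aeX => w [E'w nEw] /= XX'; apply: nEw => t.
    rewrite (KOiter_eq v0 eta t (fun k => esym (XX' k))).
    apply: le_trans (E'w t) _.
    apply: le_trans (threshold_final t d0 (erefl l) l1 theta0 L1 thL) _.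
    rewrite ler_wpM2r ?le_max ?lexx// divr_ge0//; last by have := ler0n R t; lra.
    have : 0 <= ln (ln (t%:R + 9)) :> R.
      apply: ln_ge0; apply: ln_ge1; have := @expR1_le9 R; have := ler0n R t; lra.
    lra.
  have mD : measurable (E' `\` E) by exact: measurableD.
  rewrite (measureDI P mE' mE) [X in (X + _)%E](measure_negligible mD negl) add0e.
  by apply: le_measure => [||w []//]; rewrite inE//; exact: measurableI.
apply: le_trans E'E; apply: le_trans core; rewrite lee_fin.
have mE0 : measurable E0.
  apply: measurable_bool_set; apply: measurable_fun_ler; last exact: measurable_cst.
  by apply: measurable_sin2 => //; exact: random_vec_cst.
have PE0' : 1 - delta ^+ 3 <= fine (P E0).
  by rewrite -lee_fin fineK// fin_num_measure.
(* The losses [delta ^+ 3] from the start and [delta] from Ville's bound add up to at most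
   [2 * delta]. *)
have : delta ^+ 3 <= delta by rewrite exprS ger_pMr// exprn_ile1// ltW.
nra.
Qed.
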